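(* For every integer $m\geq 1$ there is a constant $C_m$, depending only on $m$, such that for every monic polynomial $g(z)\in\overline{\mathbb{Q}}[z]$ of degree $m$ and every integer $d\geq 2$, \[\hat{h}_{\mathrm{crit}}(g(z^d))\geq \frac{1}{d\,m}\Big(h(g)-C_m\Big).\] In particular, for each $m\geq 1$, the set of monic polynomials $g(z)\in\overline{\mathbb{Q}}[z]$ of degree $m$ for which there exists an integer $d\geq 2$ such that $g(z^d)$ is post-critically finite is a set of bounded height.
   Context: Let $K$ be a number field containing the coefficients, $M_K$ its set of places, with absolute values $|\cdot|_v$ normalized to extend the standard absolute values on $\mathbb{Q}$, and extended to an algebraic closure. For a tuple $\mathbf{x}=(x_1,\dots,x_n)$ write $\|\mathbf{x}\|_v=\max_i|x_i|_v$ and $\log^+ t=\max\{0,\log t\}$; the Weil height is $h(\mathbf{x})=\sum_{v\in M_K}\frac{[K_v:\mathbb{Q}_v]}{[K:\mathbb{Q}]}\log^+\|\mathbf{x}\|_v$, and $h(g)$ denotes the height of the tuple of coefficients of $g$. For a polynomial $f$ of degree at least $2$ and a place $v$, $G_{f,v}(z)=\lim_{k\to\infty}\frac{\log^+|f^k(z)|_v}{\deg(f)^k}$ (where $f^k$ is the $k$-th iterate), $\lambda_{\mathrm{crit},v}(f)=\max_{f'(c)=0}G_{f,v}(c)$, and the critical height is $\hat{h}_{\mathrm{crit}}(f)=\sum_{v\in M_K}\frac{[K_v:\mathbb{Q}_v]}{[K:\mathbb{Q}]}\lambda_{\mathrm{crit},v}(f)$. A polynomial is post-critically finite (PCF) if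 the forward orbit of each of its critical points is finite. *)

(* Defs.v *)
From mathcomp Require Export all_boot all_order all_algebra all_field.
From mathcomp Require Export all_classical all_reals all_analysis.
Export Order.TTheory GRing.Theory Num.Theory.
Export numFieldNormedType.Exports.

Set Implicit Arguments.
Unset Strict Implicit.
Unset Printing Implicit Defensive.

Local Open Scope classical_set_scope.
Local Open Scope ring_scope.

(* A number field is K : fieldExtType rat, and an algebraic closure of the
   rationals is algC; only the field structure of algC is used below, never its
   order or its norm. *)

Section AbsoluteValues.
Variable R : realType.

Definition is_absval (F : fieldType) (v : F -> R) : Prop :=
  [/\ forall x, 0 <= v x,
      forall x, v x = 0 <-> x = 0,
      forall x y, v (x * y) = v x * v y
    & forall x y, v (x + y) <= v x + v y].

Definition rat_real_absval (q : rat) : R := `|ratr q|.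

Definition rat_padic_absval (p : nat) (q : rat) : R :=
  if q == 0 then 0
  else p%:R ^ ((logn p `|denq q|)%:Z - (logn p `|numq q|)%:Z).

Definition rat_std_absvals : set (rat -> R) :=
  [set u | u = rat_real_absval
           \/ exists2 p : nat, prime p & u = rat_padic_absval p].

(* Each place of K contains exactly one absolute value that restricts to a
   standard absolute value of the rationals, so M_K is identified with the set
   of these normalized absolute values. *)
Definition places (K : fieldExtType rat) : set (K -> R) :=
  [set v | is_absval v
           /\ exists2 u, rat_std_absvals u & forall q : rat, v q%:A = u q].

Definition is_extension (K : fieldExtType rat) (iota : {rmorphism K -> algC})
    (v : K -> R) (w : algC -> R) : Prop :=
  is_absval w /\ forall x, w (iota x) = v x.

End AbsoluteValues.

Arguments places R K : clear implicits.

Section LocalDegree.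
Variables (R : realType) (K : fieldExtType rat) (v : K -> R).

Definition is_cauchy (x : nat -> K) : Prop :=
  forall e : R, 0 < e -> \forall i & j \near \oo, v (x i - x j) < e.

Definition is_null (x : nat -> K) : Prop := (v \o x) @ \oo --> (0 : R).

(* The completion K_v is the ring of v-Cauchy sequences of K modulo the null
   sequences, and Q_v is the subfield of K_v consisting of the classes of the
   v-Cauchy sequences of rationals.  The predicate says that the classes of the
   sequences e i form a basis of the Q_v-vector space K_v, all operations and
   equalities being written on representatives. *)
Definition is_local_basis (n : nat) (e : 'I_n -> nat -> K) : Prop :=
  [/\ forall i, is_cauchy (e i),
      forall x, is_cauchy x ->
        exists2 a : 'I_n -> nat -> rat,
          forall i, is_cauchy (fun k => (a i k)%:A)
          & is_null (fun k => x k - \sum_(i < n) a i k *: e i k)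
    & forall a : 'I_n -> nat -> rat,
        (forall i, is_cauchy (fun k => (a i k)%:A)) ->
        is_null (fun k => \sum_(i < n) a i k *: e i k) ->
        forall i, is_null (fun k => (a i k)%:A)].

(* [K_v : Q_v]; the default value 0 is never taken at a place, where K_v is
   finite-dimensional over Q_v. *)
Definition local_degree : nat :=
  xget 0%N [set n | exists e : 'I_n -> nat -> K, is_local_basis e].

End LocalDegree.

Section Heights.
Variable R : realType.

(* ln 0 = 0 in the library, which gives log_plus 0 = 0 as required. *)
Definition log_plus (t : R) : R := Num.max 0 (ln t).

Definition tuple_norm (F : fieldType) (v : F -> R) (s : seq F) : R :=
  \big[Num.max/0]_(x <- s) v x.

Definition local_weight (K : fieldExtType rat) (v : K -> R) : R :=
  (local_degree v)%:R / (\dim {:K})%:R.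

(* Sums over M_K are sums of nonnegative terms, taken in the extended reals. *)
Definition weil_height (K : fieldExtType rat) (s : seq K) : \bar R :=
  \esum_(v in places R K) (local_weight v * log_plus (tuple_norm v s))%:E.

Definition poly_height (K : fieldExtType rat) (g : {poly K}) : \bar R :=
  weil_height (polyseq g).

Definition poly_iter (F : fieldType) (f : {poly F}) (k : nat) (z : F) : F :=
  iter k (fun x => f.[x]) z.

Definition escape_rate (w : algC -> R) (f : {poly algC}) (z : algC) : R :=
  limn (fun k => log_plus (w (poly_iter f k z)) / ((size f).-1 ^ k)%:R).

(* For deg f >= 2 the set is finite and nonempty, so the supremum is a
   maximum. *)
Definition lambda_crit (w : algC -> R) (f : {poly algC}) : R :=
  sup [set escape_rate w f c | c in [set c | root f^`() c]].

(* ext v is the chosen extension of v to the algebraic closure. *)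
Definition crit_height (K : fieldExtType rat) (ext : (K -> R) -> algC -> R)
    (f : {poly algC}) : \bar R :=
  \esum_(v in places R K) (local_weight v * lambda_crit (ext v) f)%:E.

End Heights.

Definition is_PCF (f : {poly algC}) : Prop :=
  forall c, root f^`() c -> finite_set (range (fun k => poly_iter f k c)).

(* Main.v *)
From HB Require Import structures.
Require Import Defs.
From mathcomp Require Import ring lra zify.

(* Write [B] for the largest absolute value, at a place [v], of a critical value of
   [g] or of [g(0)], and [A] for the largest absolute value of a critical point of
   [g].  By homogeneity [A^m <= c B] for some [c]: in the limit of a sequence of
   counterexamples, [h = g - g(0)] would vanish at all its critical points, which
   forces [h = (z - a)^m], hence [a = 0] and all critical points are [0].  Hence the
   coefficients of [g] are [O(B)] and, if [B] is large, [f(z) = g(z^d)] behaves like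
   [z^(dm)] for [|z| >= B], because [|z^d| >= B^2] is much larger than [A] and
   [|g(0)|^(1/m)]; so the critical value of [f] of size [B] escapes at rate
   [log B + O(1)].  This gives [log^+ |g|_v <= d m lambda_(crit,v)(f) + C_v], where
   [C_v] depends only on [m] and on the restriction of [v] to the rationals, and
   [C_v = 0] if [v] lies over a prime [p > m].  The constants add up because the local
   degrees of the places above a given place of the rationals sum to at most
   [[K : Q]].

   A PCF polynomial has critical height [0]; to apply the inequality to it, each place
   of [K] has to be extended to an absolute value of the algebraic numbers. *)

(** The field [algC] is neither complete nor locally compact for an absolute value [w] as above, so
    the limit of counterexamples is taken algebraically. Sequences form a ring, bounded sequences a
    subring [B] of it, and null sequences an ideal [I] of [B] that contains a bounded sequence as
    soon as it contains its square or its multiple by one of [1, ..., m]. The statement about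
    polynomials that vanish at their critical points holds modulo any such [I]. This also lets the
    absolute value vary along the sequence, as it must: the constant may depend only on the
    restriction to the rationals, not on the extension.

    With the closed and the open unit ball in place of the bounded and the null sequences, the same
    algebra gives the constant 1 exactly at primes [p > m], which compactness could not; hence only
    finitely many places of the rationals contribute an error. *)

Set Implicit Arguments.
Unset Strict Implicit.
Unset Printing Implicit Defensive.

Local Open Scope classical_set_scope.
Local Open Scope ring_scope.

(** * Absolute values *)

Section AbsvalTheory.
Variables (R : realType) (F : fieldType) (v : F -> R).
Hypothesis hv : is_absval v.

Lemma absval_ge0 x : 0 <= v x. Proof. by case: hv. Qed.

Lemma absvalM x y : v (x * y) = v x * v y. Proof. by case: hv. Qed.

Lemma absvalD x y : v (x + y) <= v x + v y. Proof. by case: hv. Qed.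

Lemma absval_eq0 x : (v x == 0) = (x == 0).
Proof. by case: hv => _ h _ _; apply/eqP/eqP => /h. Qed.

Lemma absval0 : v 0 = 0. Proof. by apply/eqP; rewrite absval_eq0. Qed.

Lemma absval_gt0 x : (0 < v x) = (x != 0).
Proof. by rewrite lt0r absval_eq0 absval_ge0 andbT. Qed.

Lemma absval1 : v 1 = 1.
Proof.
by apply: (@mulfI _ (v 1)); rewrite ?absval_eq0 ?oner_neq0 // -absvalM !mulr1.
Qed.

Lemma absvalX x n : v (x ^+ n) = v x ^+ n.
Proof. by elim: n => [|n IHn]; rewrite ?absval1 // !exprS absvalM IHn. Qed.

Lemma absvalN x : v (- x) = v x.
Proof.
suff vN1 : v (-1) = 1 by rewrite -mulN1r absvalM vN1 mul1r.
have : v (-1) ^+ 2 = 1 by rewrite -absvalX sqrrN expr1n absval1.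
move/eqP; rewrite sqrf_eq1 => /orP[/eqP//|/eqP vN].
by have := absval_ge0 (-1); rewrite vN oppr_ge0 ler10.
Qed.

Lemma absvalV x : v x^-1 = (v x)^-1.
Proof.
have [->|x0] := eqVneq x 0; first by rewrite invr0 absval0 invr0.
apply: (@mulfI _ (v x)); first by rewrite absval_eq0.
by rewrite -absvalM !divff ?absval1 ?absval_eq0.
Qed.

Lemma absvalB x y : v (x - y) <= v x + v y.
Proof. by rewrite -(absvalN y) absvalD. Qed.

Lemma absvalBC x y : v (x - y) = v (y - x).
Proof. by rewrite -absvalN opprB. Qed.

Lemma absval_lerB x y : v x - v y <= v (x - y).
Proof. by rewrite lerBlDr (le_trans _ (absvalD _ _)) // subrK. Qed.

Lemma absval_lerD x y : v x - v y <= v (x + y).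
Proof. by rewrite -[y in x + y]opprK -(absvalN y) absval_lerB. Qed.

Lemma absval_sum (I : Type) (r : seq I) (P : pred I) (G : I -> F) :
  v (\sum_(i <- r | P i) G i) <= \sum_(i <- r | P i) v (G i).
Proof.
elim/big_ind2: _ => [|x a y b xa yb|//]; first by rewrite absval0.
by rewrite (le_trans (absvalD _ _)) ?lerD.
Qed.

(* [v (x + y) ^ n <= (n + 1) max(v x, v y) ^ n] for all [n]. *)
Lemma absval_ultrametric : (forall n : nat, v n%:R <= 1) ->
  forall x y, v (x + y) <= Num.max (v x) (v y).
Proof.
move=> vn x y; set M := Num.max _ _; rewrite leNgt; apply/negP => ltM.
have M_ge0 : 0 <= M by rewrite le_max absval_ge0.
have vxy_gt0 : 0 < v (x + y) by apply: le_lt_trans ltM.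
have le_pow n : v (x + y) ^+ n <= n.+1%:R * M ^+ n.
  rewrite -absvalX exprDn (le_trans (absval_sum _ _ _)) //.
  rewrite mulr_natl -[X in M ^+ n *+ X]card_ord -sumr_const ler_sum // => i _.
  rewrite -mulr_natl !absvalM !absvalX.
  have le1 : v x ^+ (n - i) * v y ^+ i <= M ^+ n.
    have -> : M ^+ n = M ^+ (n - i) * M ^+ i by rewrite -exprD subnK // -ltnS.
    by rewrite ler_pM ?exprn_ge0 ?absval_ge0 // lerXn2r ?nnegrE ?absval_ge0 // le_max lexx ?orbT.
  rewrite -[leRHS]mul1r ler_pM ?mulr_ge0 ?exprn_ge0 ?absval_ge0 //.
have [M0|M_gt0] := leP M 0.
  have := le_pow 1%N; rewrite !expr1 => /(lt_le_trans ltM).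
  by have -> : M = 0; [apply/le_anti; rewrite M0|rewrite mulr0 ltxx].
have q_gt1 : 1 < v (x + y) / M by rewrite ltr_pdivlMr ?mul1r.
set q := v (x + y) / M in q_gt1.
have le_q n : q ^+ n <= n.+1%:R.
  by rewrite expr_div_n ler_pdivrMr ?exprn_gt0.
have bern n : 1 + n%:R * (q - 1) <= q ^+ n.
  elim: n => [|n IHn]; first by rewrite mul0r addr0.
  rewrite exprSr -natr1; have n0 : 0 <= n%:R :> R by [].
  have q1 : 0 <= q - 1 by lra.
  have := ler_wpM2r (ltW (lt_trans ltr01 q_gt1)) IHn.
  have : 0 <= n%:R * (q - 1) * (q - 1) by rewrite !mulr_ge0.
  nra.
(* Bernoulli's bound is linear, like the bound [n + 1] that it has to contradict; squaring it makes
   it quadratic. *)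
have bern2 n : (1 + n%:R * (q - 1)) ^+ 2 <= n.+1.*2%:R.
  have n0 : 0 <= n%:R :> R by [].
  have ge0 : 0 <= 1 + n%:R * (q - 1) by rewrite addr_ge0 // mulr_ge0 // subr_ge0 ltW.
  apply: le_trans (_ : q ^+ n ^+ 2 <= _); first by rewrite lerXn2r ?nnegrE ?exprn_ge0 // ltW // (lt_trans ltr01).
  rewrite -exprM (le_trans (le_q _)) // ler_nat; lia.
have q1 : 0 < q - 1 by lra.
pose b := Num.bound (4 / (q - 1) ^+ 2).
have : 4 / (q - 1) ^+ 2 < b.+1%:R.
  by rewrite (lt_le_trans (archi_boundP _)) ?divr_ge0 ?sqr_ge0 // ler_nat.
have n1 : 1 <= b.+1%:R :> R by rewrite ler1n.
rewrite ltr_pdivrMr ?exprn_gt0 //; have := bern2 b.+1.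
rewrite -muln2 natrM -(natr1 b.+1).
move: (b.+1%:R) (q - 1) q1 n1 => N e e_gt0 N1 le2N ltN.
have N0 : 0 < N by lra.
have := ltN; rewrite -(ltr_pM2r N0) => ltN2.
have : 0 < N * e by rewrite mulr_gt0.
nra.
Qed.

End AbsvalTheory.

(** * Weak approximation *)

Section WeakApproximation.
Variables (R : realType) (F : fieldType).

Lemma absvalXz (v : F -> R) : is_absval v -> forall x (k : int), v (x ^ k) = v x ^ k.
Proof.
move=> hv x [n|n]; first by rewrite -!exprnP absvalX.
by rewrite !NegzE -!exprnN absvalV // absvalX.
Qed.

Lemma small_expr (a e : R) : 0 <= a < 1 -> 0 < e -> \forall n \near \oo, a ^+ n < e.
Proof.
move=> /andP[a0 a1] e0; have /cvg_expr/cvgr0_norm_lt : `|a| < 1 by rewrite ger0_norm.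
move=> /(_ _ e0); apply: filterS => n; apply: le_lt_trans; exact: ler_norm.
Qed.

Lemma large_expr (a M : R) : 1 < a -> \forall n \near \oo, M < a ^+ n.
Proof.
move=> a1; have a0 : 0 < a by apply: lt_trans a1.
have M0 : 0 < `|M| + 1 by rewrite ltr_wpDl.
have ai : 0 <= a^-1 < 1 by rewrite invr_ge0 ltW //= invf_lt1.
have Mi : 0 < (`|M| + 1)^-1 by rewrite invr_gt0.
have := small_expr ai Mi; apply: filterS => n.
rewrite exprVn ltf_pV2 ?posrE ?exprn_gt0 // => lt.
by rewrite (le_lt_trans (ler_norm M)) // (lt_trans _ lt) // ltrDl.
Qed.

(** On the logarithmic scale the powers of [q] sit at the same equally spaced positions for both
    absolute values. If [v2 y < v1 y], the gap between [v2 (y ^ n)] and [v1 (y ^ n)] grows with [n];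
    once it exceeds the spacing, some [q ^ k] lies strictly inside it, and [y ^ n / q ^ k]
    separates. *)
Lemma separate_two (v1 v2 : F -> R) (q : F) : is_absval v1 -> is_absval v2 ->
  v1 q = v2 q -> 1 < v1 q -> v1 != v2 -> exists z, 1 < v1 z /\ v2 z < 1.
Proof.
move=> h1 h2 eqq q1 v12.
have [y ltv] : exists y, v2 y < v1 y.
  (* If [v1 <= v2] everywhere, applying this to inverses gives equality. *)
  apply: contrapT => /forallNP nlt; case/eqP: v12; apply/funext => y.
  have le12 x : v1 x <= v2 x by rewrite leNgt; apply/negP/nlt.
  apply/le_anti; rewrite le12 /=.
  have [->|y0] := eqVneq y 0; first by rewrite (absval0 h1) (absval0 h2).
  have := le12 y^-1; rewrite (absvalV h1) (absvalV h2) lef_pV2 // posrE absval_gt0 //.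
have y0 : y != 0 by apply: contraTneq ltv => ->; rewrite (absval0 h1) (absval0 h2) ltxx.
have [p1 p2] : 0 < v1 y /\ 0 < v2 y by rewrite (absval_gt0 h1) (absval_gt0 h2).
have q0 : 0 < v1 q by apply: lt_trans q1.
have lq0 : 0 < ln (v1 q) by rewrite ln_gt0.
have lt_ln : 0 < ln (v1 y) - ln (v2 y) by rewrite subr_gt0 ltr_ln.
have [n ltn] : exists n : nat, ln (v1 q) < n%:R * (ln (v1 y) - ln (v2 y)).
  exists (Num.bound (ln (v1 q) / (ln (v1 y) - ln (v2 y)))).
  by rewrite -ltr_pdivrMr // archi_boundP // divr_ge0 // ltW.
have [k [lek gtk]] : exists k : int, k%:~R * ln (v1 q) <= n%:R * ln (v2 y) + ln (v1 q)
    /\ n%:R * ln (v2 y) < k%:~R * ln (v1 q).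
  exists (Num.floor (n%:R * ln (v2 y) / ln (v1 q)) + 1).
  split; last by rewrite -ltr_pdivrMr // floorD1_gt.
  by rewrite intrD mulrDl mul1r lerD2r -ler_pdivlMr // floor_le.
exists (y ^+ n * q ^ (- k)).
rewrite !(absvalM h1, absvalM h2, absvalX h1, absvalX h2, absvalXz h1, absvalXz h2) -eqq.
rewrite -!invr_expz.
have ln_expz (a : R) (j : int) : 0 < a -> ln (a ^ j) = j%:~R * ln a.
  move=> a0; case: j => [j|j]; first by rewrite -exprnP lnXn // mulr_natl.
  by rewrite NegzE -exprnN lnV ?posrE ?exprn_gt0 // lnXn // mulrNz mulNr mulr_natl.
have qk : 0 < v1 q ^ k by rewrite exprz_gt0.
rewrite ltr_pdivlMr // mul1r ltr_pdivrMr // mul1r.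
split; rewrite -ltr_ln ?posrE ?exprn_gt0 // (ln_expz _ _ q0) lnXn // -[_ *+ n]mulr_natl //.
by apply: le_lt_trans lek _; rewrite -ltrBrDl -mulrBr.
Qed.

Lemma approx_one (v : F -> R) x (e : R) : is_absval v -> 1 < v x -> 0 < e ->
  \forall n \near \oo, v (x ^+ n / (1 + x ^+ n) - 1) < e.
Proof.
move=> hv x1 e0; have := large_expr (1 + e^-1) x1; apply: filterS => n ltn.
have ei : 0 < e^-1 by rewrite invr_gt0.
have le1 : v x ^+ n - 1 <= v (1 + x ^+ n).
  by rewrite -(absvalX hv) -(absval1 hv) [1 + _]addrC; apply: absval_lerD.
have pos : 0 < v (1 + x ^+ n) by apply: lt_le_trans le1; lra.
have n0 : 1 + x ^+ n != 0 by rewrite -(absval_gt0 hv).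
have -> : x ^+ n / (1 + x ^+ n) - 1 = - (1 + x ^+ n)^-1 by field.
rewrite (absvalN hv) (absvalV hv) -[ltRHS]invrK ltf_pV2 ?posrE //; lra.
Qed.

Lemma approx_zero (v : F -> R) x (e : R) : is_absval v -> v x < 1 -> 0 < e ->
  \forall n \near \oo, v (x ^+ n / (1 + x ^+ n)) < e.
Proof.
move=> hv x1 e0; have hx : 0 <= v x < 1 by rewrite absval_ge0.
have m0 : 0 < Num.min (e / 2) (1 / 2) by rewrite lt_min !divr_gt0.
have := small_expr hx m0; apply: filterS => n; rewrite lt_min => /andP[le2 le12].
have le1 : 1 - v x ^+ n <= v (1 + x ^+ n).
  by rewrite -(absvalX hv) -(absval1 hv); apply: absval_lerD.
have vn : 0 <= v x ^+ n by rewrite exprn_ge0 // absval_ge0.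
have pos : 0 < v (1 + x ^+ n) by apply: lt_le_trans le1; lra.
rewrite (absvalM hv) (absvalV hv) (absvalX hv) ltr_pdivrMr //.
apply: lt_le_trans (_ : e * (1 / 2) <= _); first lra.
by rewrite ler_wpM2l ?ltW //; lra.
Qed.

(** The Artin-Whaples induction. Let [x] separate [v] from [s], and [y] separate [v] from [w]. If
    [w x <= 1], then [x ^ n * y] works for large [n]. Otherwise [x ^ n] is replaced by
    [x ^ n / (1 + x ^ n)], which tends to 1 at [v] and [w] and to 0 on [s]. *)
Lemma separate_seq (v : F -> R) (s : seq (F -> R)) (q : F) : is_absval v ->
    1 < v q -> (forall w, w \in s -> [/\ is_absval w, w q = v q & w != v]) ->
  exists z, 1 < v z /\ forall w, w \in s -> w z < 1.
Proof.
move=> hv q1; elim: s => [|w s IHs] hs; first by exists q; split.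
have [x [vx sx]] : exists z, 1 < v z /\ forall w, w \in s -> w z < 1.
  by apply: IHs => w' w's; apply: hs; rewrite in_cons w's orbT.
have [hw eqw neqw] := hs w (mem_head _ _).
have [y [vy wy]] : exists z, 1 < v z /\ w z < 1.
  by apply: (separate_two hv hw (esym eqw)); rewrite // eq_sym.
have hsv w' : w' \in s -> is_absval w' by move=> w's; case: (hs w'); rewrite ?in_cons ?w's ?orbT.
have near_s (t : nat -> F) :
    (forall w', w' \in s -> forall e, 0 < e -> \forall n \near \oo, w' (t n) < e) ->
    \forall n \near \oo, forall w', w' \in s -> w' (t n * y) < 1.
  move=> ht; elim: (s) ht hsv => [|w' s' IH] ht hsv'; first exact: nearW.
  have {}IH := IH (fun w'' h => ht w'' (mem_behead (s := w' :: s') h))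
     (fun w'' h => hsv' w'' (mem_behead (s := w' :: s') h)).
  have hw' : is_absval w' := hsv' _ (mem_head _ _).
  have e0 : 0 < (w' y + 1)^-1 by rewrite invr_gt0 ltr_wpDl // absval_ge0.
  near=> n => w''; rewrite in_cons => /orP[/eqP->|]; last by move: w''; near: n.
  have tn : w' (t n) < (w' y + 1)^-1 by near: n; exact: ht (mem_head _ _) _ e0.
  rewrite (absvalM hw') (le_lt_trans (_ : _ <= (w' y + 1)^-1 * w' y)) //.
    by rewrite ler_wpM2r ?absval_ge0 // ltW.
  by rewrite mulrC ltr_pdivrMr ?ltr_wpDl ?absval_ge0 // mul1r ltrDl.
have [wx|wx] := leP (w x) 1.
  have hxs w' : w' \in s -> forall e, 0 < e -> \forall n \near \oo, w' (x ^+ n) < e.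
    move=> w's e e0; have := small_expr (a := w' x) _ e0.
    rewrite (absval_ge0 (hsv _ w's)) sx // => /(_ isT); apply: filterS => n.
    by rewrite (absvalX (hsv _ w's)).
  have [n] := filter_ex (near_s _ hxs); move=> hn.
  exists (x ^+ n * y); split.
    rewrite (absvalM hv) (absvalX hv) (lt_le_trans vy) // ler_peMl ?absval_ge0 //.
    by rewrite exprn_ege1 // ltW.
  move=> w'; rewrite in_cons => /orP[/eqP->|]; last exact: hn.
  rewrite (absvalM hw) (absvalX hw) (le_lt_trans _ wy) // ler_piMl ?absval_ge0 //.
  by rewrite exprn_ile1 ?absval_ge0.
have hxs w' : w' \in s -> forall e, 0 < e ->
    \forall n \near \oo, w' (x ^+ n / (1 + x ^+ n)) < e.
  by move=> w's e e0; apply: approx_zero => //; [exact: hsv|exact: sx].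
have hxs' := near_s _ hxs.
(* Chosen so that [(1 - e1) * v y = 1] and [(1 + e2) * w y < 1]. *)
pose e1 := (v y - 1) / v y; pose e2 := (1 - w y) / (1 + w y).
have y0 : 0 < v y by apply: lt_trans vy.
have wy0 : 0 <= w y by rewrite absval_ge0.
have e1_gt0 : 0 < e1 by rewrite divr_gt0 // subr_gt0.
have e2_gt0 : 0 < e2 by rewrite divr_gt0 ?subr_gt0 // ltr_wpDr.
have h1 := approx_one hv vx e1_gt0; have h2 := approx_one hw wx e2_gt0.
have [n [hs' [hn1 hn2]]] := filter_ex (filterI hxs' (filterI h1 h2)).
set t := x ^+ n / (1 + x ^+ n) in hs' hn1 hn2.
exists (t * y); split.
  have : 1 - v t < e1.
    by apply: le_lt_trans hn1; rewrite -(absval1 hv) [v (t - _)]absvalBC // absval_lerB.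
  rewrite /e1 ltr_pdivlMr // (absvalM hv); lra.
move=> w'; rewrite in_cons => /orP[/eqP->|]; last exact: hs'.
have : w t - 1 < e2.
  by apply: le_lt_trans hn2; rewrite -(absval1 hw) absval_lerB.
have wy1 : 0 < 1 + w y by lra.
rewrite /e2 (ltr_pdivlMr _ _ wy1) (absvalM hw) => ltt.
have wt0 : 0 <= w t by rewrite absval_ge0.
nra.
Unshelve. all: by end_near. Qed.

End WeakApproximation.

(** * Sums of local degrees *)

Lemma near_inftyP (P : nat -> Prop) :
  (\forall n \near \oo, P n) <-> exists N, forall n, (N <= n)%N -> P n.
Proof. by split=> -[N]; [move=> _ PN; exists N => n Nn; apply: PN|move=> PN; exists N]. Qed.

Section CauchyNull.
Variables (R : realType) (K : fieldExtType rat) (v : K -> R).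

Lemma is_cauchyP (x : nat -> K) : is_cauchy v x <->
  forall e : R, 0 < e -> exists N, forall i j, (N <= i)%N -> (N <= j)%N -> v (x i - x j) < e.
Proof.
split=> hx e e0.
  have [[A B] /= [[N1 _ hA] [N2 _ hB]] hAB] := hx e e0.
  exists (maxn N1 N2) => i j; rewrite !geq_max => /andP[i1 i2] /andP[j1 j2].
  by apply: (hAB (i, j)); split=> /=; [apply: hA|apply: hB].
have [N hN] := hx e e0.
exists ([set n | (N <= n)%N], [set n | (N <= n)%N]); first by split; exists N.
by case=> i j /= [iN jN]; apply: hN.
Qed.

Lemma is_nullP (x : nat -> K) : (forall y, 0 <= v y) -> is_null v x <->
  forall e : R, 0 < e -> \forall k \near \oo, v (x k) < e.
Proof.
move=> v0; split=> [/cvgr0Pnorm_lt hx e /hx|hx].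
  by apply: filterS => n; rewrite /= ger0_norm.
by apply/cvgr0Pnorm_lt => e /hx; apply: filterS => n; rewrite /= ger0_norm.
Qed.

End CauchyNull.

(** * Cauchy subsequences in the unit ball of the rationals *)

Section BolzanoWeierstrass.
Variables (R : realType) (u : rat -> R).
Hypothesis hu : is_absval u.

(** Stands in for the compactness of the unit ball of the completion of the rationals at [u], so
    that everything can be said with Cauchy sequences of rationals. *)
Definition totally_bounded_ball : Prop := forall e : R, 0 < e ->
  exists s : seq rat, forall q, u q <= 1 -> exists2 x, x \in s & u (q - x) < e.

Lemma ultrafilter_finType (G : set_system nat) (T : finType) (c : nat -> T) :
  UltraFilter G -> exists t, G [set k | c k = t].
Proof.
move=> UG; apply: contrapT => /forallNP ht.
have : \forall k \near G, forall t, c k != t.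
  apply: filter_forall => t.
  have [|] := in_ultra_setVsetC [set k | c k = t] UG; first by move/ht.
  by apply: filterS => k /= /eqP.
by move=> /filter_ex[k /(_ (c k))]; rewrite eqxx.
Qed.

(* The indices of the subsequence are picked in a decreasing sequence of members
   of an ultrafilter on which the variables vary less and less. *)
Lemma bolzano_weierstrass (S T : finType) (a : nat -> S -> rat) (c : nat -> T) :
    totally_bounded_ball -> (forall k s, u (a k s) <= 1) ->
  exists (phi : nat -> nat) (t : T),
    [/\ forall k, (k <= phi k)%N, forall k, c (phi k) = t &
      forall (e : R), 0 < e -> exists N, forall i j s, (N <= i)%N -> (N <= j)%N ->
        u (a (phi i) s - a (phi j) s) < e].
Proof.
move=> tb a1; have [G [UG sG]] := ultraFilterLemma (eventually_filter).
have [t Gt] := ultrafilter_finType c UG.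
have osc n : exists2 A, G A & forall i j s, A i -> A j -> u (a i s - a j s) < n.+1%:R^-1.
  have e0 : 0 < n.+1%:R^-1 / 2 :> R by rewrite divr_gt0.
  have [xs hxs] := tb _ e0.
  have /choice[f hf] : forall ks : nat * S, exists i : 'I_(size xs),
      u (a ks.1 ks.2 - xs`_i) < n.+1%:R^-1 / 2.
    move=> [k s] /=; have [x xxs lt] := hxs _ (a1 k s).
    have lti : (index x xs < size xs)%N by rewrite index_mem.
    by exists (Ordinal lti); rewrite /= nth_index.
  (* There are finitely many ways to assign a small ball to each [s]; the ultrafilter singles out
     one of them. *)
  have [d Gd] := ultrafilter_finType (fun k => [ffun s => f (k, s)]) UG.
  exists [set k | [ffun s => f (k, s)] = d] => // i j s /= /ffunP/(_ s) + /ffunP/(_ s).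
  rewrite !ffunE => fi fj; have := hf (i, s); have := hf (j, s); rewrite fi fj /=.
  move: (xs`_(d s)) => x lj li.
  rewrite (_ : a i s - a j s = (a i s - x) - (a j s - x)); last by ring.
  by rewrite (le_lt_trans (absvalB hu _ _)) // [ltRHS]splitr ltrD.
have [A GA hA] : exists2 A : nat -> set nat, forall n, G (A n) &
    forall n i j s, A n i -> A n j -> u (a i s - a j s) < n.+1%:R^-1.
  have /choice[A hA] : forall n, exists A, G A /\
      forall i j s, A i -> A j -> u (a i s - a j s) < n.+1%:R^-1.
    by move=> n; have [A GA hA] := osc n; exists A.
  by exists A => n; case: (hA n).
have /choice[phi hphi] : forall n, exists k, [/\ (n <= k)%N, c k = t &
    forall i : 'I_n.+1, A i k].
  move=> n; have Gn : G [set k | (n <= k)%N] by apply: sG; exists n.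
  have GAn : \forall k \near G, forall i : 'I_n.+1, A i k.
    by apply: filter_forall => i; apply: GA.
  have [k [? [? ?]]] := filter_ex (filterI Gn (filterI Gt GAn)).
  by exists k.
exists phi, t; split=> [k|k|e e0]; try by case: (hphi k).
pose N := Num.bound e^-1; exists N => i j s Ni Nj.
have hN : N.+1%:R^-1 < e.
  rewrite -[ltRHS]invrK ltf_pV2 ?posrE ?invr_gt0 //.
  by rewrite (lt_le_trans (archi_boundP _)) ?ler_nat // invr_ge0 ltW.
apply: lt_trans hN; apply: hA.
  by have [_ _ /(_ (Ordinal (Ni : (N < i.+1)%N)))] := hphi i.
by have [_ _ /(_ (Ordinal (Nj : (N < j.+1)%N)))] := hphi j.
Qed.

End BolzanoWeierstrass.

Lemma linear_dependence (F : fieldType) (V : vectType F) (S : finType) (X : S -> V) :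
  (\dim {:V} < #|S|)%N ->
  exists2 a : S -> F, exists s, a s != 0 & \sum_s a s *: X s = 0.
Proof.
move=> ltdim; pose t := [tuple X (enum_val i) | i < #|S|].
have nfree : ~~ free t.
  apply: contraL ltdim; rewrite -leqNgt /free size_tuple => /eqP <-.
  exact/dimvS/subvf.
have [b [b0 [i bi]]] : exists b : 'I_#|S| -> F,
    \sum_i b i *: t`_i = 0 /\ exists i, b i <> 0.
  apply: contrapT => /forallNP hb; case/negP: nfree; apply/freeP => b b0 i.
  by apply: contrapT => bi; apply: (hb b); split=> //; exists i.
exists (fun s => b (enum_rank s)).
  by exists (enum_val i); rewrite enum_valK; apply/eqP.
rewrite -[RHS]b0 (reindex _ (onW_bij _ (@enum_val_bij S))) /=.
by apply: eq_bigr => j _; rewrite enum_valK -(tnth_nth 0 t j) tnth_mktuple.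
Qed.

Section LocalDegreeSum.
Variables (R : realType) (K : fieldExtType rat) (u : rat -> R).
Hypotheses (tb : totally_bounded_ball u) (u1 : exists q, 1 < u q).

Definition lies_over : set (K -> R) :=
  fun v => is_absval v /\ forall q : rat, v q%:A = u q.

Lemma absvalZ v a x : lies_over v -> v (a *: x) = u a * v x.
Proof. by case=> hv hvu; rewrite -mulr_algl absvalM // hvu. Qed.

Lemma lies_over_absval v : lies_over v -> is_absval u.
Proof.
case=> hv hvu; split=> [q|q|p q|p q]; rewrite -!hvu.
- exact: absval_ge0.
- split=> [/eqP|->]; last by rewrite scale0r absval0.
  by rewrite absval_eq0 // scaler_eq0 oner_eq0 orbF => /eqP.
- by rewrite -absvalM // -scalerAl mul1r scalerA.
- by rewrite scalerDl absvalD.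
Qed.

(** All absolute values over [u] agree at a rational [q] with [1 < u q], so distinct ones can be
    separated. *)
Lemma approx_idempotent (s : seq (K -> R)) (v : K -> R) : lies_over v ->
    (forall w, w \in s -> lies_over w /\ w != v) ->
  exists t : nat -> K, (forall e, 0 < e -> \forall n \near \oo, v (t n - 1) < e) /\
    forall w, w \in s -> forall e, 0 < e -> \forall n \near \oo, w (t n) < e.
Proof.
move=> [hv hvu] hs; have [q uq] := u1.
have [|w /hs[[hw hwu] neq]|z [vz sz]] := @separate_seq _ _ v s q%:A hv; first by rewrite hvu.
  by rewrite hwu hvu.
exists (fun n => z ^+ n / (1 + z ^+ n)); split=> [e|w ws e]; first exact: approx_one.
by apply: approx_zero; [case: (hs w ws) => -[]|exact: sz].
Qed.

(** Targets with a single nonzero coordinate suffice: a member of a local basis is approximated at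
    its own place, and 0 at all others. *)
Lemma simultaneous_approx (r : nat) (V : 'I_r -> K -> R) (l : 'I_r) (x : K) (e : R) :
    injective V -> (forall l, lies_over (V l)) -> 0 < e ->
  exists y, forall j, V j (y - (if l == j then x else 0)) < e.
Proof.
move=> injV hV e0.
have [w|t [tl tj]] := @approx_idempotent [seq V j | j <- enum 'I_r & j != l] _ (hV l).
  by case/mapP=> j; rewrite mem_filter => /andP[jl _] ->; rewrite (inj_eq injV).
have : \forall n \near \oo, forall j, V j (t n * x - (if l == j then x else 0)) < e.
  apply: filter_forall => j.
  have hVj : is_absval (V j) by case: (hV j).
  have e1 : 0 < e / (V j x + 1) by rewrite divr_gt0 // ltr_wpDl // absval_ge0.
  have lt_e y : V j y < e / (V j x + 1) -> V j (y * x) < e.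
    rewrite absvalM // => hy; rewrite (le_lt_trans (_ : _ <= e / (V j x + 1) * V j x)) //.
      by rewrite ler_wpM2r ?absval_ge0 // ltW.
    rewrite mulrAC ltr_pdivrMr ?ltr_wpDl ?absval_ge0 // ltr_pM2l //.
    by rewrite ltrDl.
  case: (eqVneq l j) lt_e e1 => [<-|lj] lt_e e1.
    have := tl _ e1; apply: filterS => n /lt_e.
    by rewrite mulrBl mul1r.
  have Vj : V j \in [seq V j | j <- enum 'I_r & j != l].
    by apply: map_f; rewrite mem_filter eq_sym lj mem_enum.
  have := tj _ Vj _ e1; apply: filterS => n /lt_e.
  by rewrite subr0.
by move=> /filter_ex[n hn]; exists (t n * x).
Qed.

Lemma sum_sigT (r : nat) (n : 'I_r -> nat) (W : nmodType)
    (G : {l : 'I_r & 'I_(n l)} -> W) :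
  \sum_s G s = \sum_(l < r) \sum_(i < n l) G (Tagged (fun l => 'I_(n l)) i).
Proof. by rewrite sig_big_dep; apply: eq_bigr => -[]. Qed.

(* If the local degrees summed to more than [dim K], the elements of [K] that
   approximate the local bases at all places at once would be linearly dependent
   over the rationals; in the limit a dependence relation with coefficients in
   the unit ball, one of them equal to 1, contradicts the independence of a
   local basis. *)
Lemma sum_independent_le (r : nat) (V : 'I_r -> K -> R) (n : 'I_r -> nat)
    (e : forall l, 'I_(n l) -> nat -> K) :
    injective V -> (forall l, lies_over (V l)) ->
    (forall l i, is_cauchy (V l) (e l i)) ->
    (forall l (a : 'I_(n l) -> nat -> rat),
      (forall i, is_cauchy (V l) (fun k => (a i k)%:A)) ->
      is_null (V l) (fun k => \sum_(i < n l) a i k *: e l i k) ->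
      forall i, is_null (V l) (fun k => (a i k)%:A)) ->
  (\sum_l n l <= \dim {:K})%N.
Proof.
move=> injV hV e_cauchy e_free; pose S : finType := {l : 'I_r & 'I_(n l)}.
have cardS : #|S| = (\sum_l n l)%N.
  by rewrite -sum1_card sum_sigT; apply: eq_bigr => l _; rewrite sum1_card card_ord.
rewrite -cardS leqNgt; apply/negP => ltdim.
pose E (s : S) := e (tag s) (tagged s).
have hA l : is_absval (V l) by case: (hV l).
have k0 k : 0 < k.+1%:R^-1 :> R by [].
have /choice[X hX] : forall ks : nat * S, exists y, forall j,
    V j (y - (if tag ks.2 == j then E ks.2 ks.1 else 0)) < ks.1.+1%:R^-1.
  by move=> [k s]; apply: simultaneous_approx.
have /choice[a ha] : forall k, exists a : S -> rat,
    [/\ \sum_s a s *: X (k, s) = 0, forall s, u (a s) <= 1 & exists s, a s = 1].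
  move=> k; have [b [s0 bs0] Db] := linear_dependence (fun s => X (k, s)) ltdim.
  have hu : is_absval u := lies_over_absval (hV (tag s0)).
  pose s1 := [arg max_(s > s0) u (b s)]%O.
  have hs1 s : u (b s) <= u (b s1) by rewrite /s1; case: arg_maxP => // i _; apply.
  have bs1 : b s1 != 0.
    by rewrite -(absval_gt0 hu) (lt_le_trans _ (hs1 s0)) // absval_gt0.
  exists (fun s => b s / b s1); split; last by exists s1; rewrite divff.
    rewrite -[RHS](scaler0 _ (b s1)^-1) -[in RHS]Db scaler_sumr; apply: eq_bigr => s _.
    by rewrite scalerA mulrC.
  by move=> s; rewrite absvalM // absvalV // ler_pdivrMr ?absval_gt0 // mul1r.
have /choice[c hc] : forall k, exists s, a k s = 1 by move=> k; case: (ha k).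
have hu : is_absval u := lies_over_absval (hV (tag (c 0%N))).
have a1 k s : u (a k s) <= 1 by case: (ha k).
(* Besides making the coefficients Cauchy, the subsequence fixes the index [s0] at which the
   coefficient is 1. *)
have [phi [s0 [phi_ge c_phi phi_cauchy]]] := bolzano_weierstrass hu c tb a1.
pose l := tag s0; pose b (i : 'I_(n l)) k := a (phi k) (Tagged (fun l => 'I_(n l)) i).
have b_cauchy i : is_cauchy (V l) (fun k => (b i k)%:A).
  apply/is_cauchyP => d /phi_cauchy[N hN]; exists N => k1 k2 h1 h2.
  by rewrite -scalerBl (proj2 (hV l)) hN.
have small_comb k : V l (\sum_(i < n l) b i k *: e l i (phi k)) <= #|S|%:R / k.+1%:R.
  have [Da _ _] := ha (phi k).
  (* Subtracting the exact relation between the [X (phi k, s)] leaves only approximation errors: at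
     the place [l] the targets with another tag are 0. *)
  have -> : \sum_(i < n l) b i k *: e l i (phi k) =
      \sum_s a (phi k) s *: ((if tag s == l then E s (phi k) else 0) - X (phi k, s)).
    under [RHS]eq_bigr do rewrite scalerBr.
    rewrite sumrB Da subr0 sum_sigT (bigD1 l) //= [X in _ + X]big1 ?addr0 => [|j jl].
      by apply: eq_bigr => i _; rewrite eqxx.
    by rewrite big1 // => i _; rewrite (negPf jl) scaler0.
  rewrite (le_trans (absval_sum (hA l) _ _ _)) // mulr_natl -[#|S|]/(#|xpredT|) -sumr_const.
  rewrite ler_sum // => s _; rewrite absvalZ // -[leRHS]mul1r.
  rewrite ler_pM ?absval_ge0 // absvalBC // (le_trans (ltW (hX (phi k, s) l))) //=.
  by rewrite lef_pV2 ?posrE // ler_nat ltnS.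
have b_null : is_null (V l) (fun k => \sum_(i < n l) b i k *: e l i k).
  apply/is_nullP => [y|d d0]; first exact: absval_ge0.
  have d1 : 0 < d / 2 / (n l).+1%:R by rewrite !divr_gt0.
  have /near_inftyP near1 : exists N, forall k, (N <= k)%N ->
      forall i : 'I_(n l), V l (e l i k - e l i (phi k)) < d / 2 / (n l).+1%:R.
    apply/near_inftyP; apply: filter_forall => i; apply/near_inftyP.
    have [N hN] := (is_cauchyP _ _).1 (e_cauchy l i) _ d1.
    by exists N => k Nk; apply: hN => //; apply: leq_trans (phi_ge k).
  have near2 : \forall k \near \oo, #|S|%:R / k.+1%:R < d / 2.
    pose N := Num.bound (#|S|%:R / (d / 2)); exists N => // k /= Nk.
    rewrite ltr_pdivrMr // mulrC -ltr_pdivrMr ?divr_gt0 //.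
    rewrite (lt_le_trans (archi_boundP _)) ?ler_nat ?(leq_trans Nk) //.
    by rewrite divr_ge0 // divr_ge0 // ltW.
  apply: filterS2 near1 near2 => k h1 h2.
  (* The coefficients are taken at [phi k] but the basis at [k]; as [k <= phi k] and the [e l i] are
     Cauchy, moving from one index to the other costs little. *)
  have -> : \sum_(i < n l) b i k *: e l i k = \sum_(i < n l) b i k *: e l i (phi k)
      + \sum_(i < n l) b i k *: (e l i k - e l i (phi k)).
    by rewrite -big_split; apply: eq_bigr => i _; rewrite /= -scalerDr addrCA subrr addr0.
  rewrite (le_lt_trans (absvalD (hA l) _ _)) // [ltRHS]splitr ltr_leD //.
    by rewrite (le_lt_trans (small_comb k)).
  rewrite (le_trans (absval_sum (hA l) _ _ _)) //.
  rewrite (le_trans (_ : _ <= \sum_(i < n l) d / 2 / (n l).+1%:R)) //.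
    rewrite ler_sum // => i _; rewrite absvalZ // -[leRHS]mul1r.
    by apply: ler_pM; rewrite ?(absval_ge0 hu) ?(absval_ge0 (hA l)) ?a1 ?(ltW (h1 i)).
  rewrite sumr_const card_ord -[leLHS]mulr_natr mulrAC ler_pdivrMr //.
  by rewrite ler_wpM2l ?ler_nat // ltW // divr_gt0.
have /is_nullP := e_free l b b_cauchy b_null (tagged s0).
move=> /(_ (absval_ge0 (hA l)) 1 ltr01)/filter_ex[k].
have DT : Tagged (fun l => 'I_(n l)) (tagged s0) = s0 :> S by case: (s0).
by rewrite (proj2 (hV l)) /b DT -(c_phi k) hc absval1 // ltxx.
Qed.

Lemma sum_local_degree_le (s : seq (K -> R)) : uniq s ->
  (forall v, v \in s -> lies_over v) -> (\sum_(v <- s) local_degree v <= \dim {:K})%N.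
Proof.
move=> uniq_s hs.
pose V (l : 'I_(size s)) := nth (fun=> 0) s l.
have injV : injective V.
  by move=> i j /eqP; rewrite nth_uniq // => /eqP/ord_inj.
have hV l : lies_over (V l) by apply/hs/mem_nth.
have /= hE l : {e : 'I_(local_degree (V l)) -> nat -> K |
    (forall i, is_cauchy (V l) (e i)) /\
    (forall (a : 'I_(local_degree (V l)) -> nat -> rat),
      (forall i, is_cauchy (V l) (fun k => (a i k)%:A)) ->
      is_null (V l) (fun k => \sum_i a i k *: e i k) ->
      forall i, is_null (V l) (fun k => (a i k)%:A))}.
  apply: cid; rewrite /local_degree; case: xgetP => [n _ [e [? _ ?]]|_]; first by exists e.
  (* Where [xget] falls back to 0, the family is indexed by the empty ['I_0] and is independent for
     free. *)
  by exists (fun _ _ => 0); split=> [[]|a _ _ []].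
rewrite (big_nth (fun=> 0)) big_mkord.
apply: (@sum_independent_le _ V _ (fun l => sval (hE l))) => // l.
- by case: (svalP (hE l)).
- by case: (svalP (hE l)).
Qed.

End LocalDegreeSum.

(** * Standard absolute values of the rationals *)

Section StandardAbsvals.
Variable R : realType.

Lemma totally_bounded_real : totally_bounded_ball (@rat_real_absval R).
Proof.
move=> e e0; have [N Npos hN] : exists2 N : nat, (0 < N)%N & N%:R^-1 < e.
  exists (Num.bound e^-1).+1 => //.
  rewrite -[ltRHS]invrK ltf_pV2 ?posrE ?invr_gt0 ?ltr0n //.
  by rewrite (lt_le_trans (archi_boundP _)) ?ler_nat // invr_ge0 ltW.
have N0 : 0 < N%:R :> rat by rewrite ltr0n.
exists [seq k%:R / N%:R - 1 | k <- iota 0 (N + N).+1] => q.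
rewrite /rat_real_absval -ratr_norm -(rmorph1 ratr) ler_rat ler_norml => /andP[q1 q2].
have qN : 0 <= (q + 1) * N%:R by rewrite mulr_ge0 //; lra.
have /andP[t1 t2] := truncn_itv qN; set k := Num.truncn _ in t1 t2.
exists (k%:R / N%:R - 1).
  apply/mapP; exists k => //; rewrite mem_iota /= add0n ltnS -(ler_nat rat) (le_trans t1) //.
  by rewrite natrD; nra.
apply: le_lt_trans hN; rewrite -ratr_norm -(ratr_nat R N) -fmorphV ler_rat.
have -> : q - (k%:R / N%:R - 1) = ((q + 1) * N%:R - k%:R) / N%:R.
  by field; rewrite gt_eqF.
rewrite normrM normfV (ger0_norm (ltW N0)) -[leRHS]mul1r ler_wpM2r ?invr_ge0 ?(ltW N0) //.
rewrite ger0_norm ?subr_ge0 // lerBlDr ltW // (lt_le_trans t2) //.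
by rewrite -natr1 addrC.
Qed.

Section Padic.
Variables (p : nat) (p_prime : prime p).
Local Notation u := (@rat_padic_absval R p).

Let p_gt0 : 0 < p%:R :> R. Proof. by rewrite ltr0n prime_gt0. Qed.

Let p_gt1 : 1 < p%:R :> R. Proof. by rewrite ltr1n prime_gt1. Qed.

Lemma padic_int (z : int) : z != 0 -> u z%:~R = p%:R ^- logn p `|z|.
Proof.
move=> z0; rewrite /rat_padic_absval intr_eq0 (negPf z0) numq_int denq_int.
by rewrite logn1 sub0r -exprnN.
Qed.

Lemma padic_int_le1 (z : int) : u z%:~R <= 1.
Proof.
have [->|z0] := eqVneq z 0; first by rewrite /rat_padic_absval eqxx ler01.
by rewrite padic_int // invf_le1 ?exprn_gt0 // exprn_ege1 // ltW.
Qed.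

Lemma padic_coprime (z : int) : coprime p `|z| -> u z%:~R = 1.
Proof.
move=> pz; rewrite padic_int; first by rewrite logn_coprime // expr0 invr1.
by apply: contraTneq pz => ->; rewrite /coprime gcdn0 neq_ltn prime_gt1 ?orbT.
Qed.

Lemma padic_small (n : nat) : (0 < n < p)%N -> u n%:R = 1.
Proof.
move=> /andP[n0 np]; rewrite -[n%:R]/(n%:Z%:~R) padic_coprime //=.
by rewrite prime_coprime // gtnNdvd.
Qed.

Hypothesis hu : is_absval u.

Let u_p : u p%:R = p%:R^-1.
Proof.
rewrite (_ : u p%:R = u p%:Z%:~R) // padic_int /=; last by rewrite -lt0n prime_gt0.
by rewrite logn_prime // eqxx expr1.
Qed.

Lemma padic_gt1 : exists q, 1 < u q.
Proof. by exists p%:R^-1; rewrite (absvalV hu) u_p invrK. Qed.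

(** A [p]-integral rational is congruent modulo [p ^ n] to an integer in [[0, p ^ n)]: its numerator
    times a Bezout inverse of its denominator, reduced modulo [p ^ n]. *)
Lemma totally_bounded_padic : totally_bounded_ball u.
Proof.
move=> e e0; have /filter_ex[n ltn] := @large_expr R _ e^-1 p_gt1.
have pne : (p%:R ^+ n)^-1 < e by rewrite -[ltRHS]invrK ltf_pV2 ?posrE ?invr_gt0 // exprn_gt0.
exists [seq k%:R | k <- iota 0 (p ^ n)] => q uq.
have den_p : coprime p `|denq q|.
  have [->|q0] := eqVneq q 0; first by rewrite (denq_int 0) coprimen1.
  rewrite prime_coprime //; apply/negP => pd; move: uq; apply/negP; rewrite -ltNge.
  have pn : ~~ (p %| `|numq q|)%N.
    apply/negP => pn; have := prime_gt1 p_prime; rewrite ltnNge => /negP; apply.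
    by rewrite dvdn_leq // -(eqP (coprime_num_den q)) dvdn_gcd pn.
  rewrite /rat_padic_absval (negPf q0) [logn p `|numq q|]logn_coprime ?prime_coprime //.
  rewrite subr0 -exprnP exprn_egt1 // -lt0n logn_gt0 mem_primes p_prime pd andbT.
  by rewrite absz_gt0 denq_neq0.
have den1 : u (denq q)%:~R = 1 by rewrite padic_coprime.
have cop : coprimez (denq q) (p ^ n)%N%:Z by rewrite coprimezE /= coprime_sym coprimeXl.
have [a [b ab]] := Bezoutz (denq q) (p ^ n)%N.
rewrite (eqP cop) in ab.
have pn0 : (p ^ n)%N%:Z != 0 by rewrite -lt0n expn_gt0 prime_gt0.
pose x := ((numq q * a) %% (p ^ n)%N)%Z.
have x0 : 0 <= x by rewrite modz_ge0.
have xlt : x < (p ^ n)%N by rewrite ltz_pmod // ltz_nat expn_gt0 prime_gt0.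
exists (`|x|%N)%:R.
  by apply/mapP; exists `|x|%N => //; rewrite mem_iota add0n /= -ltz_nat gez0_abs.
apply: le_lt_trans pne.
have -> : (`|x|%N)%:R = (`|x|%N%:Z)%:~R :> rat by [].
rewrite (gez0_abs x0).
set y := ((numq q * a) %/ (p ^ n)%N)%Z.
have Dx : x = numq q * a - y * (p ^ n)%N by rewrite [numq q * a](divz_eq _ (p ^ n)%N) addrAC subrr add0r.
have DN : numq q - x * denq q = (numq q * b + y * denq q) * (p ^ n)%N.
  by rewrite -[X in X - _]mulr1 -ab Dx; ring.
have -> : q - x%:~R = (numq q * b + y * denq q)%:~R * p%:R ^+ n / (denq q)%:~R.
  rewrite -natrX -[(p ^ n)%:R]/((p ^ n)%N%:Z%:~R) -intrM -DN intrB intrM mulrBl.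
  by rewrite divq_num_den mulfK // intr_eq0 denq_neq0.
rewrite !(absvalM hu) (absvalV hu) den1 invr1 mulr1 (absvalX hu) u_p exprVn.
by rewrite ler_piMl ?padic_int_le1 // invr_ge0 exprn_ge0 // ltW.
Qed.

End Padic.

Lemma real_gt1 : exists q, 1 < @rat_real_absval R q.
Proof. by exists 2; rewrite /rat_real_absval ratr_nat ger0_norm // ltr1n. Qed.

Lemma place_over (K : fieldExtType rat) (v : K -> R) : places R K v ->
  exists2 u, rat_std_absvals u & lies_over u v.
Proof. by case=> hv [u hu hvu]; exists u. Qed.

Lemma lies_over_place (K : fieldExtType rat) (u : rat -> R) (v : K -> R) : rat_std_absvals u ->
  lies_over u v -> places R K v.
Proof. by move=> hu [hv hvu]; split=> //; exists u. Qed.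

Lemma local_weight_ge0 (K : fieldExtType rat) (v : K -> R) : 0 <= local_weight v.
Proof. by rewrite divr_ge0. Qed.

Lemma esum_local_weight_le1 (K : fieldExtType rat) (u : rat -> R) : rat_std_absvals u ->
  (\esum_(v in lies_over (K := K) u) (local_weight v)%:E <= 1%:E)%E.
Proof.
move=> hu; apply: ge_ereal_sup => _ [X [finX sX] <-].
rewrite fsbig_finite //= sumEFin lee_fin -mulr_suml ler_pdivrMr ?ltr0n ?adim_gt0 // mul1r.
rewrite -natr_sum ler_nat; set xs := finmap.enum_fset _.
have hs v : v \in xs -> lies_over u v.
  by rewrite /xs in_fset_set // => /set_mem/sX.
have uniq_xs : uniq xs by apply: finmap.fset_uniq.
(* That [u] is an absolute value is read off a place above it, so the empty sum is treated apart. *)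
case: xs hs uniq_xs => [|v0 xs] hs uniq_xs; first by rewrite big_nil.
have hu' := lies_over_absval (hs v0 (mem_head _ _)).
case: hu => [Du|[p p_prime Du]]; apply: sum_local_degree_le uniq_xs hs; rewrite {}Du in hu' *.
- exact: totally_bounded_real.
- exact: real_gt1.
- exact: totally_bounded_padic.
- exact: padic_gt1.
Qed.

End StandardAbsvals.

(** * Extension of absolute values *)

Section Extension.
Variables (R : realType) (F L : fieldType) (iota : {rmorphism F -> L}) (v : F -> R).
Hypotheses (hv : is_absval v) (alg : forall x, algebraicOver iota x).

(* [U (x, a)] stands for [|x| <= a]: a gauge is a system of mutually compatible
   upper bounds for an absolute value that extends [v]. *)
Definition is_gauge (U : set (L * R)) : Prop :=
  [/\ forall c a, v c <= a -> U (iota c, a),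
      forall x y a b, U (x, a) -> U (y, b) -> U (x + y, a + b),
      forall x y a b, U (x, a) -> U (y, b) -> U (x * y, a * b),
      forall x a, U (x, a) -> 0 <= a
    & forall a, U (1, a) -> 1 <= a].

Definition base_gauge : set (L * R) :=
  [set xa | exists2 c, xa.1 = iota c & v c <= xa.2].

Lemma base_gaugeP : is_gauge base_gauge.
Proof.
split=> [c a|x y a b|x y a b|x a|a].
- by exists c.
- move=> [c /= -> ca] [d /= -> db]; exists (c + d); rewrite ?rmorphD //=.
  by rewrite (le_trans (absvalD hv _ _)) ?lerD.
- move=> [c /= -> ca] [d /= -> db]; exists (c * d); rewrite ?rmorphM //= absvalM //.
  by rewrite ler_pM ?(absval_ge0 hv).
- by move=> [c _ /=]; apply: le_trans; rewrite absval_ge0.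
- by case=> c /= /esym/eqP; rewrite fmorph_eq1 => /eqP-> ; rewrite absval1.
Qed.

Lemma maximal_gauge :
  exists2 U, is_gauge U & forall W, is_gauge W -> U `<=` W -> W `<=` U.
Proof.
(* Uniting with [base_gauge] makes the union of the empty chain acceptable to Zorn's lemma. *)
pose P : set (set (L * R)) := [set A | is_gauge (A `|` base_gauge)].
have [|A [PA maxA]] := @Zorn_bigcup _ P.
  move=> C CP totC.
  have CU X : C X -> X `|` base_gauge `<=` \bigcup_(Y in C) Y `|` base_gauge.
    by move=> CX; apply: setSU; apply: bigcup_sup.
  have two z t : (\bigcup_(Y in C) Y `|` base_gauge) z ->
      (\bigcup_(Y in C) Y `|` base_gauge) t ->
      exists W, [/\ is_gauge W, W `<=` \bigcup_(Y in C) Y `|` base_gauge, W z & W t].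
    move=> [[X CX Xz]|bz] [[Y CY Yt]|bt].
    - have [XY|YX] := totC _ _ CX CY.
        by exists (Y `|` base_gauge); split; [exact: CP|exact: CU|left; apply: XY|left].
      by exists (X `|` base_gauge); split; [exact: CP|exact: CU|left|left; apply: YX].
    - by exists (X `|` base_gauge); split; [exact: CP|exact: CU|left|right].
    - by exists (Y `|` base_gauge); split; [exact: CP|exact: CU|right|left].
    - by exists base_gauge; split; [exact: base_gaugeP|right|by []|by []].
  split=> [c a ca|x y a b Ux Uy|x y a b Ux Uy|x a Ux|a Ux].
  - by right; exists c.
  - have [W [[_ WD _ _ _] sW Wx Wy]] := two _ _ Ux Uy; exact/sW/WD.
  - have [W [[_ _ WM _ _] sW Wx Wy]] := two _ _ Ux Uy; exact/sW/WM.
  - have [W [[_ _ _ W0 _] sW Wx _]] := two _ _ Ux Ux; exact: W0 Wx.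
  - have [W [[_ _ _ _ W1] sW Wx _]] := two _ _ Ux Ux; exact: W1 Wx.
exists (A `|` base_gauge) => // W gW sW; apply: contrapT => nW.
have pAW : A `<` W.
  split=> [z Az|WA]; first by apply: sW; left.
  by apply: nW => z /WA; left.
apply: (maxA W pAW); rewrite /P /= (_ : W `|` base_gauge = W) //.
by apply/setUidl => z bz; apply: sW; right.
Qed.

(** * Maximal gauges are absolute values *)

Section Maximal.
Variable U : set (L * R).
Hypotheses (gU : is_gauge U) (maxU : forall W, is_gauge W -> U `<=` W -> W `<=` U).

Let Uv c a : v c <= a -> U (iota c, a). Proof. by case: gU => h _ _ _ _; apply: h. Qed.
Let UD x y a b : U (x, a) -> U (y, b) -> U (x + y, a + b).
Proof. by case: gU => _ h _ _ _; apply: h. Qed.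
Let UM x y a b : U (x, a) -> U (y, b) -> U (x * y, a * b).
Proof. by case: gU => _ _ h _ _; apply: h. Qed.
Let Uge0 x a : U (x, a) -> 0 <= a. Proof. by case: gU => _ _ _ h _; apply: h. Qed.
Let Uge1 a : U (1, a) -> 1 <= a. Proof. by case: gU => _ _ _ _ h; apply: h. Qed.

Let U00 : U (0, 0). Proof. by rewrite -(rmorph0 iota); apply: Uv; rewrite absval0. Qed.
Let U11 : U (1, 1). Proof. by rewrite -(rmorph1 iota); apply: Uv; rewrite absval1. Qed.
Let UN x a : U (x, a) -> U (- x, a).
Proof.
move=> Ux; rewrite -mulN1r -[a]mul1r; apply: UM Ux.
by rewrite -(rmorphN1 iota); apply: Uv; rewrite absvalN // absval1.
Qed.
Let Ule x a b : U (x, a) -> a <= b -> U (x, b).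
Proof.
move=> Ux ab; rewrite -[x]addr0 -(subrK a b) [b - a + a]addrC; apply: UD => //.
by rewrite -(rmorph0 iota); apply: Uv; rewrite absval0 // subr_ge0.
Qed.
Let UX x a n : U (x, a) -> U (x ^+ n, a ^+ n).
Proof. by move=> Ux; elim: n => [|n IHn]; rewrite ?expr0 // !exprS; apply: UM. Qed.
Let Usum (I : Type) (r : seq I) (P : pred I) (G : I -> L) (H : I -> R) :
  (forall i, P i -> U (G i, H i)) ->
  U (\sum_(i <- r | P i) G i, \sum_(i <- r | P i) H i).
Proof.
move=> GH; elim: r => [|i r IHr]; first by rewrite !big_nil.
by rewrite !big_cons; case: ifP => // Pi; apply: UD => //; apply: GH.
Qed.

Definition gauge_poly (C : {poly L}) (A : {poly R}) : Prop :=
  forall i, U (C`_i, A`_i).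

Let gauge_polyC c a : U (c, a) -> gauge_poly c%:P a%:P.
Proof. by move=> Uc i; rewrite !coefC; case: ifP. Qed.
Let gauge_polyX : gauge_poly 'X 'X.
Proof. by move=> i; rewrite !coefX; case: (i == 1%N). Qed.
Let gauge_polyD C A D B : gauge_poly C A -> gauge_poly D B -> gauge_poly (C + D) (A + B).
Proof. by move=> CA DB i; rewrite !coefD; apply: UD. Qed.
Let gauge_polyM C A D B : gauge_poly C A -> gauge_poly D B -> gauge_poly (C * D) (A * B).
Proof. by move=> CA DB i; rewrite !coefM; apply: Usum => j _; apply: UM. Qed.
Let gauge_polyXn n : gauge_poly 'X^n 'X^n.
Proof. by move=> i; rewrite !coefXn; case: (i == n). Qed.
Let gauge_poly_ge0 C A b : gauge_poly C A -> 0 <= b -> 0 <= A.[b].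
Proof.
move=> CA b0; rewrite horner_coef sumr_ge0 // => i _.
by rewrite mulr_ge0 ?exprn_ge0 // (Uge0 (CA i)).
Qed.
Let gauge_poly_ge_coef C A b k : gauge_poly C A -> 0 <= b -> A`_k * b ^+ k <= A.[b].
Proof.
move=> CA b0; have [ltk|gek] := ltnP k (size A); last first.
  by rewrite nth_default // mul0r (gauge_poly_ge0 CA).
rewrite horner_coef (bigD1 (Ordinal ltk)) //= lerDl sumr_ge0 // => i _.
by rewrite mulr_ge0 ?exprn_ge0 // (Uge0 (CA i)).
Qed.

(** The pairs [(C.[y], A.[b])] include [U] and [(y, b)] and satisfy every condition on a gauge
    except possibly the last; since [U] is maximal, that one has to fail. *)
Lemma not_gaugeP y b : 0 <= b -> ~ U (y, b) ->
  exists C A, [/\ gauge_poly C A, C.[y] = 1 & A.[b] < 1].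
Proof.
move=> b0 nU; apply: contrapT => /forallNP hC; apply: nU.
pose W : set (L * R) := [set xa | exists C A, [/\ gauge_poly C A, C.[y] = xa.1 & A.[b] = xa.2]].
have UW : U `<=` W.
  by move=> [x a] Ux; exists x%:P, a%:P; rewrite !hornerC; split=> //; apply: gauge_polyC.
apply: (maxU _ UW); last by exists 'X, 'X; rewrite !hornerX.
split=> [c a ca|x x' a a'|x x' a a'|x a|a].
- by apply/UW/Uv.
- move=> [C [A [CA /= <- <-]]] [D [B [DB /= <- <-]]].
  by exists (C + D), (A + B); rewrite !hornerD; split=> //; apply: gauge_polyD.
- move=> [C [A [CA /= <- <-]]] [D [B [DB /= <- <-]]].
  by exists (C * D), (A * B); rewrite !hornerM; split=> //; apply: gauge_polyM.
- by move=> [C [A [CA /= _ <-]]]; apply: gauge_poly_ge0 CA b0.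
move=> [C [A [CA /= C1 <-]]]; rewrite leNgt; apply/negP => A1.
by apply: (hC C); exists A.
Qed.

(** Serves to replace the monomial ['X^k] of [C] by a polynomial [D] with the same value at the
    point considered, keeping track of the bounds. *)
Let subst_top k (C D : {poly L}) (A B : {poly R}) :
  gauge_poly C A -> gauge_poly D B ->
  gauge_poly (C - C`_k *: 'X^k + C`_k *: D) (A - A`_k *: 'X^k + A`_k *: B).
Proof.
move=> CA DB; apply: gauge_polyD => i; last by rewrite !coefZ; apply: UM.
rewrite !coefB !coefZ !coefXn; have [->|_] := eqVneq i k; first by rewrite !mulr1 !subrr.
by rewrite !mulr0 !subr0.
Qed.

Let finite x : Prop := exists a, U (x, a).

Let finiteD x y : finite x -> finite y -> finite (x + y).
Proof. by move=> [a ?] [b ?]; exists (a + b); apply: UD. Qed.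
Let finiteM x y : finite x -> finite y -> finite (x * y).
Proof. by move=> [a ?] [b ?]; exists (a * b); apply: UM. Qed.
Let finiteX x n : finite x -> finite (x ^+ n).
Proof. by move=> [a ?]; exists (a ^+ n); apply: UX. Qed.
Let finite_iota c : finite (iota c).
Proof. by exists (v c); apply: Uv. Qed.
Let finiteN x : finite x -> finite (- x).
Proof. by move=> [a ?]; exists a; apply: UN. Qed.

(** A monic equation for [x^-1] over [F], multiplied by a suitable power of [x], expresses [x^-1] as
    a polynomial in [x] over [F]. *)
Let finiteV x : finite x -> finite x^-1.
Proof.
move=> fx; have [->|x0] := eqVneq x 0; first by rewrite invr0 -(rmorph0 iota).
have /integral_algebraic/integral_inv[p p_mon /rootP px] := alg x.
have [n szp] : exists n, size p = n.+1.
  by exists (size p).-1; rewrite prednK // size_poly_gt0 monic_neq0.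
have lcp : p`_n = 1 by rewrite -[RHS](monicP p_mon) /lead_coef szp.
move: px; rewrite horner_coef size_map_poly szp big_ord_recr /= coef_map /= lcp rmorph1 mul1r.
case: n {lcp szp} => [|n]; first by rewrite big_ord0 add0r expr0 => /eqP; rewrite oner_eq0.
move/addr0_eq => Dx.
have -> : x^-1 = \sum_(i < n.+1) - iota p`_i * x ^+ (n - i).
  have -> : x^-1 = x^-1 ^+ n.+1 * x ^+ n.
    by rewrite exprS exprVn mulfVK // expf_neq0.
  rewrite -Dx -sumrN mulr_suml; apply: eq_bigr => i _.
  rewrite coef_map /= -!mulNr -mulrA; congr (_ * _).
  have -> : x ^+ n = x ^+ (n - i) * x ^+ i by rewrite -exprD subnK // -ltnS.
  by rewrite exprVn mulrCA mulVf ?mulr1 // expf_neq0.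
apply: (big_ind finite); [by exists 0|exact: finiteD|move=> i _].
by apply: finiteM; [apply/finiteN/finite_iota|apply: finiteX].
Qed.

(* An element of degree [n > 1] over the field of elements of finite gauge could
   be given a large enough bound [r]: a relation [C(x) = 1] contradicting that
   bound reduces to degree [< n], where it has to be the trivial one. *)
Lemma gauge_finite x : finite x.
Proof.
pose has_min n := exists p : {poly L},
  [/\ p \is monic, forall i, finite p`_i, root p x & size p = n.+1].
have [n0 hn0] : exists n, has_min n.
  have /integral_algebraic[p p_mon px] := alg x.
  exists (size p).-1, (map_poly iota p); split=> //; first by rewrite map_monic.
    by move=> i; rewrite coef_map; apply: finite_iota.
  by rewrite size_map_poly prednK // size_poly_gt0 monic_neq0.
have ex_n : exists n, `[< has_min n >] by exists n0; apply/asboolP.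
case: (ex_minnP ex_n) => n /asboolP[P [P_mon Pfin Px szP]] minn {n0 hn0 ex_n}.
have n_gt0 : (0 < n)%N.
  case: n szP {minn} => // szP; move: Px; have := monicP P_mon.
  rewrite /lead_coef szP /= => P1; rewrite (size1_polyC (eq_leq szP)) P1 rootC.
  by rewrite oner_eq0.
have minP (Q : {poly L}) : (forall i, finite Q`_i) -> (size Q <= n)%N -> Q.[x] = 0 -> Q = 0.
  move=> Qfin szQ Qx; apply/eqP; apply: contraTT isT => Q0.
  have lc0 : lead_coef Q != 0 by rewrite lead_coef_eq0.
  have /minn : `[< has_min (size Q).-1 >].
    apply/asboolP; exists ((lead_coef Q)^-1 *: Q); split.
    - by rewrite monicE lead_coefZ mulVf.
    - by move=> i; rewrite coefZ; apply: finiteM => //; apply/finiteV/Qfin.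
    - by rewrite /root hornerZ Qx mulr0.
    - by rewrite size_scale ?invr_eq0 // prednK // size_poly_gt0.
  by rewrite leqNgt prednK ?size_poly_gt0 // szQ.
have /choice[e he] : forall i, exists a, U (- P`_i, a) by move=> i; apply/finiteN/Pfin.
pose D : {poly L} := 'X^n - P; pose E := \poly_(i < n) e i.
have szD : (size D <= n)%N.
  apply/leq_sizeP => i; rewrite leq_eqVlt coefB coefXn => /orP[/eqP<-|lti].
    by rewrite eqxx (_ : P`_n = 1) ?subrr // -[RHS](monicP P_mon) /lead_coef szP.
  by rewrite gtn_eqF // nth_default ?subrr // szP.
have DE : gauge_poly D E.
  move=> i; rewrite coef_poly coefB coefXn; case: ltnP => lti.
    by rewrite ltn_eqF // sub0r.
  by rewrite -coefXn -coefB nth_default // (leq_trans szD).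
have Dx : D.[x] = x ^+ n by rewrite !hornerE (rootP Px) subr0.
have e0 i : 0 <= e i := Uge0 (he i).
(* As [r] is at least 1 and at least the sum of the [e i], [E.[r] <= r ^ n]: rewriting ['X^n] as [D]
   does not increase the bound at [r]. *)
pose r := 1 + \sum_(i < n) e i.
have r1 : 1 <= r by rewrite lerDl sumr_ge0.
have r0 : 0 <= r by apply: le_trans r1.
have Er : E.[r] <= r ^+ n.
  rewrite horner_poly; apply: le_trans (_ : \sum_(i < n) e i * r ^+ n.-1 <= _).
    apply: ler_sum => i _; rewrite ler_wpM2l // ler_weXn2l //.
    by rewrite -ltnS prednK.
  rewrite -mulr_suml (_ : r ^+ n = r * r ^+ n.-1) ?ler_wpM2r ?exprn_ge0 //.
    by rewrite lerDr.
  by rewrite -exprS prednK.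
clearbody D E.
suff Ux : U (x, r) by exists r.
apply: contrapT => /(not_gaugeP r0)[C [A [CA Cx Ar]]].
suff [C' [A' [C'A' szC' C'x A'r]]] : exists C' A',
    [/\ gauge_poly C' A', (size C' <= n)%N, C'.[x] = 1 & A'.[r] < 1].
  have C'1 : C' - 1 = 0.
    apply: minP; last by rewrite hornerD hornerN hornerC C'x subrr.
      move=> i; rewrite coefB; apply: finiteD; first by exists (A'`_i); apply: C'A'.
      by apply: finiteN; rewrite coefC; case: ifP => _; [exists 1|exists 0].
    rewrite (leq_trans (size_polyD _ _)) // geq_max szC' size_polyN size_poly1.
    exact: n_gt0.
  have : U (1, A'`_0).
    by have := C'A' 0%N; rewrite (_ : C' = 1) ?coefC //; apply/eqP; rewrite -subr_eq0 C'1.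
  move/Uge1; rewrite leNgt => /negP; apply; apply: le_lt_trans A'r.
  by have := gauge_poly_ge_coef 0 C'A' r0; rewrite expr0 mulr1.
have [k] := ubnP (size C); elim: k C A CA Cx Ar => // k IHk C A CA Cx Ar szC.
have [leCn|ltnC] := leqP (size C) n; first by exists C, A.
pose j := ((size C).-1 - n)%N.
have Dj : (size C).-1 = (j + n)%N by rewrite /j subnK // -ltnS (ltn_predK ltnC).
have DEj : gauge_poly ('X^j * D) ('X^j * E) by apply: gauge_polyM.
apply: (IHk _ _ (subst_top (size C).-1 CA DEj)).
- rewrite !(hornerD, hornerN, hornerZ, hornerM, hornerXn) Dx -exprD -Dj Cx.
  by rewrite subrK.
- rewrite !(hornerD, hornerN, hornerZ, hornerM, hornerXn); apply: le_lt_trans Ar.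
  rewrite -addrA gerDl addrC subr_le0 ler_wpM2l ?(Uge0 (CA _)) // Dj exprD.
  by rewrite ler_wpM2l ?exprn_ge0.
rewrite -ltnS; apply: leq_trans szC.
rewrite -(ltn_predK ltnC) ltnS ltnS; apply/leq_sizeP => i lei /=.
rewrite coefD coefB !coefZ coefXn coefXnM; move: lei; rewrite leq_eqVlt => /orP[/eqP<-|lti].
  rewrite eqxx mulr1 subrr add0r Dj ltnNge leq_addr /= addKn [D`_n]nth_default ?mulr0 //.
rewrite gtn_eqF // mulr0 subr0 nth_default ?add0r; last by rewrite -(ltn_predK ltnC).
case: ifP; rewrite ?mulr0 // => _; rewrite [D`_(i - j)]nth_default ?mulr0 //.
by rewrite (leq_trans szD) //; lia.
Qed.


Let relation y b n : Prop := exists C A,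
  [/\ gauge_poly C A, (size C <= n)%N, C.[y] = 1 & A.[b] < 1].

Let relation_small y b n : 0 <= b -> (n <= 1)%N -> ~ relation y b n.
Proof.
move=> b0 n1 [C [A [CA szC Cy Ab]]].
move: Cy; rewrite (size1_polyC (leq_trans szC n1)) hornerC => C0.
have := CA 0%N; rewrite C0 => /Uge1; rewrite leNgt => /negP; apply.
by apply: le_lt_trans Ab; have := gauge_poly_ge_coef 0 CA b0; rewrite expr0 mulr1.
Qed.

(* Multiplying the relation for [y^-1] by [y^n] rewrites the leading monomial
   [c y^n] of the relation for [y] as [c d_0 y^n + ...], where [|d_0| < 1].  After
   enough rewritings the remaining [c d_0^N y^n] is small enough to be moved into
   the constant term. *)
Let relation_reduce y b n m : y != 0 -> 0 < b -> (m <= n)%N ->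
  relation y b n.+1 -> relation y^-1 b^-1 m.+1 -> relation y b n.
Proof.
move=> y0 b0 lemn [C [A [CA szC Cy Ab]]] [D [E [DE szD Dy Eb]]].
have [n0|n_gt0] := posnP n.
  by case: (relation_small (ltW b0) _ (ex_intro _ C (ex_intro _ A (And4 CA szC Cy Ab)))); rewrite n0.
have b0' := ltW b0; have bi0 : 0 <= b^-1 by rewrite invr_ge0.
pose D' : {poly L} := \sum_(j < m.+1) D`_j *: 'X^(n - j).
pose E' : {poly R} := \sum_(j < m.+1) E`_j *: 'X^(n - j).
have DE' : gauge_poly D' E'.
  move=> i; rewrite !coef_sum; apply: Usum => j _; rewrite !coefZ !coefXn.
  by apply: UM => //; case: (i == _).
have szD' : (size D' <= n.+1)%N.
  apply: (big_ind (fun p : {poly L} => size p <= n.+1)%N) => [|p q szp szq|j _].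
  - by rewrite size_poly0.
  - by rewrite (leq_trans (size_polyD _ _)) // geq_max szp.
  - by rewrite (leq_trans (size_scale_leq _ _)) // size_polyXn ltnS leq_subr.
have D'n : D'`_n = D`_0.
  rewrite coef_sum big_ord_recl /= coefZ coefXn subn0 eqxx mulr1 big1 ?addr0 // => j _.
  by rewrite coefZ coefXn /= /bump /= gtn_eqF ?mulr0 //; lia.
have E'n : E'`_n = E`_0.
  rewrite coef_sum big_ord_recl /= coefZ coefXn subn0 eqxx mulr1 big1 ?addr0 // => j _.
  by rewrite coefZ coefXn /= /bump /= gtn_eqF ?mulr0 //; lia.
have D'y : D'.[y] = y ^+ n.
  rewrite -[RHS]mulr1 -Dy (horner_coef_wide _ szD) horner_sum mulr_sumr.
  apply: eq_bigr => j _; rewrite hornerZ hornerXn mulrCA; congr (_ * _).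
  have -> : y ^+ n = y ^+ (n - j) * y ^+ j.
    by rewrite -exprD subnK // (leq_trans _ lemn) // -ltnS.
  by rewrite exprVn mulfK // expf_neq0.
have E'b : E'.[b] <= b ^+ n.
  have -> : E'.[b] = b ^+ n * \sum_(j < m.+1) E`_j * b^-1 ^+ j.
    rewrite horner_sum mulr_sumr; apply: eq_bigr => j _.
    rewrite hornerZ hornerXn mulrCA; congr (_ * _).
    have -> : b ^+ n = b ^+ (n - j) * b ^+ j.
      by rewrite -exprD subnK // (leq_trans _ lemn) // -ltnS.
    by rewrite exprVn mulfK // expf_neq0 // gt_eqF.
  rewrite ler_piMr ?exprn_ge0 // (le_trans _ (ltW Eb)) //.
  set k := maxn (size E) m.+1.
  rewrite (horner_coef_wide _ (leq_maxl _ _ : (size E <= k)%N)).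
  rewrite -!(big_mkord xpredT (fun j => E`_j * b^-1 ^+ j)).
  rewrite (big_cat_nat _ (leq_maxr _ _ : (m.+1 <= k)%N)) //= lerDl sumr_ge0 // => j _.
  by rewrite mulr_ge0 ?exprn_ge0 // (Uge0 (DE j)).
have E00 : 0 <= E`_0 by apply: Uge0 (DE 0%N).
have E01 : E`_0 < 1.
  by apply: le_lt_trans Eb; have := gauge_poly_ge_coef 0 DE bi0; rewrite expr0 mulr1.
clearbody D' E'.
have iter N : exists C' A', [/\ gauge_poly C' A', (size C' <= n.+1)%N, C'.[y] = 1,
    A'.[b] <= A.[b] & C'`_n = C`_n * D`_0 ^+ N /\ A'`_n = A`_n * E`_0 ^+ N].
  elim: N => [|N [C' [A' [C'A' szC' C'y A'b [C'n A'n]]]]].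
    by exists C, A; rewrite !expr0 !mulr1.
  exists (C' - C'`_n *: 'X^n + C'`_n *: D'), (A' - A'`_n *: 'X^n + A'`_n *: E').
  split.
  - exact: subst_top.
  - rewrite (leq_trans (size_polyD _ _)) // geq_max (leq_trans (size_polyD _ _)) /=.
      by rewrite (leq_trans (size_scale_leq _ _)).
    by rewrite geq_max szC' size_polyN (leq_trans (size_scale_leq _ _)) // size_polyXn.
  - by rewrite !(hornerD, hornerN, hornerZ, hornerXn) D'y subrK.
  - rewrite !(hornerD, hornerN, hornerZ, hornerXn) (le_trans _ A'b) //.
    by rewrite -addrA gerDl addrC subr_le0 ler_wpM2l ?(Uge0 (C'A' _)).
  - rewrite !coefD !coefN !coefZ !coefXn eqxx !mulr1 !subrr !add0r D'n E'n C'n A'n.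
    by rewrite !exprSr !mulrA.
have [kap Uyn] := gauge_finite (y ^+ n).
have kap0 : 0 <= kap := Uge0 Uyn.
have An0 : 0 <= A`_n := Uge0 (CA n).
have [N EN] : exists N, A`_n * E`_0 ^+ N * kap < 1 - A.[b].
  pose e := (1 - A.[b]) / (A`_n * kap + 1).
  have d0 : 0 < A`_n * kap + 1 by rewrite ltr_wpDl ?mulr_ge0.
  have e0 : 0 < e by rewrite divr_gt0 ?subr_gt0.
  have /cvg_expr/cvgr0_norm_lt : `|E`_0| < 1 by rewrite ger0_norm.
  move=> /(_ _ e0)/filter_ex[N hN]; exists N.
  have {}hN : E`_0 ^+ N < e by apply: le_lt_trans hN; apply: ler_norm.
  rewrite mulrAC; move: hN; rewrite ltr_pdivlMr // mulrDr mulr1 mulrC.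
  by apply: le_lt_trans; rewrite lerDl exprn_ge0.
have [C' [A' [C'A' szC' C'y A'b [C'n A'n]]]] := iter N.
have Ukap : gauge_poly (y ^+ n)%:P kap%:P by apply: gauge_polyC.
exists (C' - C'`_n *: 'X^n + C'`_n *: (y ^+ n)%:P), (A' - A'`_n *: 'X^n + A'`_n *: kap%:P).
split.
- exact: subst_top.
- apply/leq_sizeP => i lei; rewrite coefD coefB !coefZ coefXn coefC.
  rewrite (gtn_eqF (leq_trans n_gt0 lei)) mulr0 addr0.
  move: lei; rewrite leq_eqVlt => /orP[/eqP<-|lti]; first by rewrite eqxx mulr1 subrr.
  by rewrite gtn_eqF // mulr0 subr0 nth_default // (leq_trans szC').
- by rewrite !(hornerD, hornerN, hornerZ, hornerXn, hornerC) C'y subrK.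
rewrite !(hornerD, hornerN, hornerZ, hornerXn, hornerC).
have : 0 <= A'`_n * b ^+ n by rewrite mulr_ge0 ?exprn_ge0 // (Uge0 (C'A' n)).
by move: EN; rewrite -A'n; lra.
Qed.

(** Chevalley's argument for valuation rings: if both failed there would be relations for [y] and
    for [y^-1], and the one of larger degree could always be shortened by means of the other. *)
Lemma gauge_dichotomy y b : y != 0 -> 0 < b -> U (y, b) \/ U (y^-1, b^-1).
Proof.
move=> y0 b0; apply: contrapT => /not_orP[nU nUV].
have [C [A [CA Cy Ab]]] := not_gaugeP (ltW b0) nU.
have bi0 : 0 < b^-1 by rewrite invr_gt0.
have [D [E [DE Dy Eb]]] := not_gaugeP (ltW bi0) nUV.
have rel1 : relation y b (size C) by exists C, A.
have rel2 : relation y^-1 b^-1 (size D) by exists D, E.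
have [k] := ubnP (size C + size D).
move: (size C) (size D) rel1 rel2 => n m {C A CA Cy Ab D E DE Dy Eb nU nUV}.
elim: k n m y b y0 b0 bi0 => // k IHk n m y b y0 b0 bi0 rel1 rel2 ltk.
case: n rel1 ltk => [|n] rel1 ltk; first exact: (relation_small (ltW b0) _ rel1).
case: m rel2 ltk => [|m] rel2 ltk; first exact: (relation_small (ltW bi0) _ rel2).
have [lemn|/ltnW lenm] := leqP m n.
  have rel1' := relation_reduce y0 b0 lemn rel1 rel2.
  by apply: (IHk n m.+1 y b y0 b0 bi0 rel1' rel2); move: ltk; rewrite addSn ltnS.
have yi0 : y^-1 != 0 by rewrite invr_eq0.
have rel1' : relation y^-1^-1 b^-1^-1 n.+1 by rewrite !invrK.
have rel2' := relation_reduce yi0 bi0 lenm rel2 rel1'.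
have bii0 : 0 < b^-1^-1 by rewrite invrK.
apply: (IHk m n.+1 y^-1 b^-1 yi0 bi0 bii0 rel2' rel1').
by move: ltk; rewrite addnC addSn ltnS.
Qed.

Definition gauge_norm x : R := inf [set a | U (x, a)].

Local Notation w := gauge_norm.

Let has_infU x : has_inf [set a | U (x, a)].
Proof. by split; [exact: gauge_finite|exists 0 => a; apply: Uge0]. Qed.

Let norm_le x a : U (x, a) -> w x <= a.
Proof. by move=> Ux; apply: inf_lbound => //; case: (has_infU x). Qed.

Let norm_lt x a : w x < a -> U (x, a).
Proof.
rewrite -subr_gt0 => lt; have [b Ub ltb] := inf_adherent lt (has_infU x).
by apply: (Ule Ub); rewrite ltW // (lt_le_trans ltb) // addrC subrK.
Qed.

Let norm_gt0 x : 0 <= w x.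
Proof. by apply: lb_le_inf => [|a]; [case: (has_infU x)|apply: Uge0]. Qed.

Let normD x y : w (x + y) <= w x + w y.
Proof.
apply/ler_addgt0Pr => e e0; have e2 : 0 < e / 2 by rewrite divr_gt0.
have -> : w x + w y + e = (w x + e / 2) + (w y + e / 2) by lra.
by apply/norm_le/UD; apply: norm_lt; rewrite ltrDl.
Qed.

Let normM_le x y : w (x * y) <= w x * w y.
Proof.
rewrite leNgt; apply/negP => lt.
have s0 : 0 < w x + w y + 1 by rewrite ltr_wpDl ?addr_ge0 ?norm_gt0.
pose e := Num.min 1 ((w (x * y) - w x * w y) / (w x + w y + 1) / 2).
have e0 : 0 < e by rewrite lt_min ltr01 !divr_gt0 // subr_gt0.
have e1 : e <= 1 by rewrite ge_min lexx.
have e2 : e * (w x + w y + 1) <= (w (x * y) - w x * w y) / 2.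
  rewrite -ler_pdivlMr // [leRHS]mulrAC ge_min lexx orbT //.
have : w (x * y) <= (w x + e) * (w y + e).
  by apply/norm_le/UM; apply: norm_lt; rewrite ltrDl.
have : e * e <= e by rewrite ler_piMl ?(ltW e0).
by move: e2; nra.
Qed.

Let norm_ext c : w (iota c) = v c.
Proof.
apply/le_anti/andP; split; first exact/norm_le/Uv.
have [->|c0] := eqVneq c 0; first by rewrite absval0.
have le1 : 1 <= w (iota c) * w (iota c^-1).
  apply: le_trans (normM_le _ _); rewrite -rmorphM divff // rmorph1.
  by apply: lb_le_inf => [|a]; [case: (has_infU 1)|apply: Uge1].
have vc0 : 0 < v c by rewrite absval_gt0.
have : w (iota c) * w (iota c^-1) <= w (iota c) * (v c)^-1.
  by apply: ler_wpM2l => //; apply/norm_le/Uv; rewrite absvalV.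
by move/(le_trans le1); rewrite ler_pdivlMr // mul1r.
Qed.

Let norm1 : w 1 = 1. Proof. by rewrite -(rmorph1 iota) norm_ext absval1. Qed.

Let norm_gt0V y : y != 0 -> 0 < w y.
Proof.
move=> y0; rewrite lt0r norm_gt0 andbT; apply/eqP => wy0.
by have := normM_le y y^-1; rewrite divff // wy0 mul0r norm1 ler10.
Qed.

(** If the product exceeded 1, a number [b] strictly between [(w y^-1)^-1] and [w y] would violate
    the dichotomy. This upgrades submultiplicativity to multiplicativity. *)
Let normV y : y != 0 -> w y * w y^-1 <= 1.
Proof.
move=> y0; have wi0 : 0 < w y^-1 by rewrite norm_gt0V // invr_eq0.
rewrite -ler_pdivlMr // div1r leNgt; apply/negP => lt.
have [b0 b1] := midf_lt lt; set b := (_ / 2) in b0 b1.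
have bpos : 0 < b by rewrite (lt_trans _ b0) // invr_gt0.
case: (gauge_dichotomy y0 bpos) => /norm_le; first by rewrite leNgt b1.
by rewrite leNgt => /negP; apply; rewrite -[ltRHS]invrK ltf_pV2 ?posrE ?invr_gt0.
Qed.

Lemma gauge_norm_absval : is_absval w /\ forall c, w (iota c) = v c.
Proof.
split; last exact: norm_ext.
split=> // [x|x y].
  split=> [wx0|->]; last by rewrite -(rmorph0 iota) norm_ext absval0.
  by apply/eqP; apply: contraT => /norm_gt0V; rewrite wx0 ltxx.
apply/le_anti; rewrite normM_le /=.
have [->|y0] := eqVneq y 0.
  by rewrite mulr0 -(rmorph0 iota) norm_ext absval0 // mulr0.
have : w x * w y <= w (x * y) * (w y * w y^-1).
  rewrite [w y * _]mulrC mulrA ler_wpM2r //.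
  by rewrite -{1}(mulfK y0 x) normM_le.
by move/le_trans; apply; rewrite ler_piMr ?normV.
Qed.

End Maximal.

Lemma absval_extension : exists w : L -> R, is_absval w /\ forall c, w (iota c) = v c.
Proof.
have [U gU maxU] := maximal_gauge.
by exists (gauge_norm U); apply: gauge_norm_absval.
Qed.

End Extension.

Lemma algC_algebraicOver (K : fieldExtType rat) (iota : {rmorphism K -> algC}) x :
  algebraicOver iota x.
Proof.
have [p [_ p_mon] hp] := minCpolyP x.
exists (map_poly (in_alg K) p); first by rewrite map_poly_eq0 monic_neq0.
rewrite -map_poly_comp (eq_map_poly (g := ratr)) ?hp ?dvdpp // => q.
exact: (fmorph_eq_rat (iota \o in_alg K)).
Qed.

Lemma place_extension (R : realType) (K : fieldExtType rat)
    (iota : {rmorphism K -> algC}) (v : K -> R) :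
  is_absval v -> exists w, is_extension iota v w.
Proof. by move=> hv; apply: absval_extension => // x; apply: algC_algebraicOver. Qed.

(** * Polynomials vanishing at their critical points *)

(** The critical points are part of the data because the definition is also used over the ring of
    sequences, where polynomials need not split. *)
Definition critical_data (A : comNzRingType) (m : nat) (h : {poly A}) (s : seq A) : Prop :=
  [/\ h \is monic, size h = m.+1, h.[0] = 0, size s = m.-1
    & h^`() = (\prod_(x <- s) ('X - x%:P)) *+ m].

Section RadicalIdeal.
Variables (A : comNzRingType) (B : subringClosed A) (I : {pred A}) (m : nat).
Hypotheses (ID : forall x y, x \in I -> y \in I -> x + y \in I)
  (IM : forall b x, b \in B -> x \in I -> b * x \in I)
  (Isqr : forall x, x \in B -> x ^+ 2 \in I -> x \in I)
  (Imuln : forall j x, (0 < j <= m)%N -> x \in B -> x *+ j \in I -> x \in I).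

Hypothesis I0 : 0 \in I.
Let IMr x b : x \in I -> b \in B -> x * b \in I.
Proof. by move=> xI bB; rewrite mulrC IM. Qed.

Let IN x : x \in I -> - x \in I.
Proof. by move=> xI; rewrite -mulN1r IM // rpredN rpred1. Qed.

Let IB x y : x \in I -> y \in I -> x - y \in I.
Proof. by move=> xI yI; rewrite ID ?IN. Qed.

Let Isum (J : Type) (r : seq J) (P : pred J) (F : J -> A) :
  (forall j, P j -> F j \in I) -> \sum_(j <- r | P j) F j \in I.
Proof. by move=> FI; apply: (big_ind (fun x => x \in I)). Qed.

Let Imulrn x n : x \in I -> x *+ n \in I.
Proof. by move=> xI; elim: n => [|n IHn]; rewrite ?mulr0n ?mulrS ?ID. Qed.

Let Ieq x y : x - y \in I -> y \in I -> x \in I.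
Proof. by move=> xyI yI; rewrite -(subrK y x) ID. Qed.

(** Only square roots can be taken in [I], so the exponent is first raised from [n] to [2 ^ n]. *)
Let Iexp x n : x \in B -> x ^+ n \in I -> x \in I.
Proof.
have Ipow2 k : forall y, y \in B -> y ^+ (2 ^ k) \in I -> y \in I.
  elim: k => [|k IHk] y yB; first by rewrite expr1.
  by rewrite expnSr exprM => yI; apply: IHk => //; apply: Isqr => //; apply: rpredX.
move=> xB xnI; apply: (Ipow2 n) => //.
by rewrite -(subnK (ltnW (ltn_expl n (ltnSn 1)))) exprD IM // rpredX.
Qed.

Let Icomp (p r : {poly A}) : (forall i, p`_i \in I) -> r \is a polyOver B ->
  forall i, (p \Po r)`_i \in I.
Proof.
move=> pI rB i; rewrite comp_polyE coef_sum; apply: Isum => j _.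
by rewrite coefZ IMr //; apply/polyOverP; apply: rpredX.
Qed.

Let divX_root (c : A) (E : {poly A}) : c \in B -> E \is a polyOver B ->
  exists2 F : {poly A}, F \is a polyOver B & E = F * ('X - c%:P) + (E.[c])%:P.
Proof.
move=> cB; elim/poly_ind: E => [|p a IHp] pB.
  by exists 0; rewrite ?rpred0 // horner0 mul0r addr0.
have {IHp}/IHp [p' p'B Dp] : p \is a polyOver B.
  by apply/polyOverP=> i; have /polyOverP/(_ i.+1) := pB;
     rewrite coefD coefMX coefC /= addr0.
exists (p + c%:P * p').
  rewrite rpredD ?rpredM ?polyOverC //.
  apply/polyOverP=> i; have /polyOverP/(_ i.+1) := pB.
  by rewrite coefD coefMX coefC /= addr0.
rewrite hornerMXaddC {1 2}Dp !rmorphD !rmorphM /=; ring.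
Qed.

(* [E(0) q_j] is in [I] by induction on [j], comparing the coefficients of [h = q E]
   with those of [h' = m q Q]; the leading coefficient of [q] is 1. *)
Let cofactor0 (h q E Q : {poly A}) :
    q \is a polyOver B -> E \is a polyOver B -> Q \is a polyOver B ->
    q \is monic -> (size q <= m.+1)%N ->
    (forall i, (h - q * E)`_i \in I) -> h^`() = (q * Q) *+ m ->
    h`_0 \in I -> E`_0 \in I.
Proof.
move=> qB EB QB q_mon szq hqE dh h0.
have cq i : q`_i \in B by apply/polyOverP.
have cE i : E`_i \in B by apply/polyOverP.
have cQ i : Q`_i \in B by apply/polyOverP.
suff qe : forall j, (j <= m)%N -> q`_j * E`_0 \in I.
  have /qe : ((size q).-1 <= m)%N by rewrite -ltnS prednK // size_poly_gt0 monic_neq0.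
  by rewrite -/(lead_coef q) (monicP q_mon) mul1r.
move=> j; elim/ltn_ind: j => -[|j] IHj ltjm.
  have := hqE 0%N; rewrite coefB coefM big_ord1 subn0 => /IN.
  by rewrite opprB => /Ieq; apply.
have qEj : q`_j.+1 * E`_0 \in B by rewrite rpredM.
(* Modulo [I], [h_(j+1) E(0)] is [q_(j+1) E(0)^2], by the coefficients of [q E], and
   [(j+1) h_(j+1) E(0)] is 0, by those of [h']. Hence [(j+1) (q_(j+1) E(0))^2] is in [I]. *)
apply: (Isqr qEj); apply: (@Imuln j.+1); rewrite ?rpredX //.
have dhj : h`_j.+1 *+ j.+1 * E`_0 \in I.
  rewrite -coef_deriv dh coefMn mulrnAl Imulrn // coefM mulr_suml Isum // => i _.
  by rewrite mulrAC IMr // IHj ?ltn_ord // ltnW // (leq_trans (ltn_ord i)).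
have := hqE j.+1; rewrite coefB coefM big_ord_recr subnn /= => hj.
have {}hj : (h`_j.+1 - q`_j.+1 * E`_0) * E`_0 \in I.
  apply: (Ieq (y := (\sum_(i < j.+1) q`_i * E`_(j.+1 - i)) * E`_0)).
    by rewrite -mulrBl IMr // -addrA -opprD [_ + \sum_(_ < _) _]addrC.
  rewrite mulr_suml Isum // => i _.
  by rewrite mulrAC IMr // IHj ?ltn_ord // ltnW // (leq_trans (ltn_ord i)).
have {}hj := Imulrn j.+1 hj.
have id4 (a b e : A) (n : nat) :
    a * (((b - a * e) * e) *+ n - b *+ n * e) = - ((a * e) ^+ 2 *+ n).
  rewrite -[_ * e *+ n]mulr_natr -[b *+ n]mulr_natr -[_ ^+ 2 *+ n]mulr_natr; ring.
have /IN : q`_j.+1 * (((h`_j.+1 - q`_j.+1 * E`_0) * E`_0) *+ j.+1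
    - h`_j.+1 *+ j.+1 * E`_0) \in I by rewrite IM // IB.
by rewrite id4 opprK.
Qed.

Let shift (c : A) (p : {poly A}) := p \Po ('X + c%:P).

Let shift_coef0 c p : (shift c p)`_0 = p.[c].
Proof. by rewrite -horner_coef0 horner_comp !hornerE. Qed.

Let shiftB c p : c \in B -> p \is a polyOver B -> shift c p \is a polyOver B.
Proof. by move=> cB pB; rewrite polyOver_comp // rpredD ?polyOverX ?polyOverC. Qed.


Let shift_horner c p x : p.[x] = (shift c p).[x - c].
Proof. by rewrite horner_comp !hornerE subrK. Qed.

Let shift_monic c p k : p \is monic -> size p = k.+1 ->
  size (shift c p) = k.+1 /\ (shift c p)`_k = 1.
Proof.
have DX : 'X + c%:P = 'X - (- c)%:P :> {poly A} by rewrite polyCN opprK.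
have szX i : size (('X + c%:P) ^+ i) = i.+1.
  have -> : ('X + c%:P) ^+ i = \prod_(x <- nseq i (- c)) ('X - x%:P).
    by rewrite big_nseq -DX iter_mulr_1.
  by rewrite size_prod_XsubC size_nseq.
move=> p_mon szp; have lck : (shift c p)`_k = 1.
  rewrite /shift comp_polyE coef_sum szp big_ord_recr /= big1 => [|i _].
    rewrite add0r coefZ; have := monicP (monic_exp k (monicXsubC (- c))).
    by rewrite -DX /lead_coef szX => ->; rewrite mulr1 -[RHS](monicP p_mon) /lead_coef szp.
  by rewrite coefZ [X in _ * X]nth_default ?mulr0 // szX.
split=> //; apply/eqP; rewrite eqn_leq; apply/andP; split.
  apply: leq_trans (size_comp_poly_leq _ _) _.
  by rewrite szp DX size_XsubC muln1.
by rewrite ltnNge; apply: contra_eqN lck => le; rewrite nth_default // eq_sym oner_neq0.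
Qed.

Let shift_prod c (s : seq A) : shift c (\prod_(x <- s) ('X - x%:P)) =
  \prod_(x <- [seq x - c | x <- s]) ('X - x%:P).
Proof.
rewrite /shift rmorph_prod big_map; apply: eq_bigr => x _.
by rewrite /= comp_polyB comp_polyX comp_polyC polyCB opprB addrA addrAC.
Qed.

Let cofactor c (s : seq A) (h E Q : {poly A}) :
    c \in B -> {subset s <= B} -> E \is a polyOver B -> Q \is a polyOver B ->
    (size s <= m)%N ->
    (forall i, (h - \prod_(x <- s) ('X - x%:P) * E)`_i \in I) ->
    h^`() = (\prod_(x <- s) ('X - x%:P) * Q) *+ m ->
    h.[c] \in I -> E.[c] \in I.
Proof.
move=> cB sB EB QB szs hqE dh hc; rewrite -(shift_coef0 c).
have tB : {in [seq x - c | x <- s], forall x, x \in B}.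
  by move=> _ /mapP[x /sB xB ->]; rewrite rpredB.
apply: (@cofactor0 (shift c h) (\prod_(x <- [seq x - c | x <- s]) ('X - x%:P))
   (shift c E) (shift c Q)); rewrite ?shiftB //.
- rewrite big_seq_cond rpred_prod // => x; rewrite andbT => /tB xB.
  by rewrite rpredB ?polyOverX ?polyOverC.
- exact: monic_prod_XsubC.
- by rewrite size_prod_XsubC size_map.
- move=> i; rewrite -shift_prod -rmorphM -rmorphB /=; apply: Icomp => //.
  by rewrite rpredD ?polyOverX ?polyOverC.
- rewrite deriv_comp dh derivD derivX derivC addr0 mulr1 -shift_prod.
  by rewrite /shift -rmorphM /= rmorphMn.
- by rewrite shift_coef0.
Qed.

(** The critical points are split off one at a time. Vanishing of [h] at the next one, [c], does not
    by itself pass to the cofactor [E], since [c] may be congruent to earlier ones; [cofactor] gives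
    it because [c] is critical. The last cofactor has degree 1. *)
Let critical_cofactor (h : {poly A}) (s : seq A) : {subset s <= B} ->
    size s = m.-1 -> (0 < m)%N -> h \is monic -> size h = m.+1 ->
    h \is a polyOver B -> h^`() = (\prod_(x <- s) ('X - x%:P)) *+ m ->
    (forall x, x \in s -> h.[x] \in I) ->
  exists2 a, a \in B &
   forall i, (h - \prod_(x <- s) ('X - x%:P) * ('X - a%:P))`_i \in I.
Proof.
move=> sB szs m_gt0 h_mon szh hB dh hs.
suff IH : forall k, (k <= size s)%N -> exists E : {poly A},
    [/\ E \is a polyOver B, E \is monic, size E = (m.+1 - k)%N
     & forall i, (h - \prod_(x <- take k s) ('X - x%:P) * E)`_i \in I].
  have [E [EB E_mon szE hE]] := IH _ (leqnn _); rewrite take_size in hE.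
  have szE2 : size E = 2%N by rewrite szE szs; lia.
  exists (- E`_0); first by rewrite rpredN; apply/polyOverP.
  rewrite polyCN opprK; suff -> : 'X + (E`_0)%:P = E by [].
  apply/polyP => -[|[|i]]; rewrite coefD coefX coefC /= ?add0r ?addr0 //.
    by rewrite -[LHS](monicP E_mon) /lead_coef szE2.
  by rewrite nth_default ?szE2.
elim=> [|k IHk] lek.
  exists h; split; rewrite ?subn0 // => i.
  by rewrite take0 big_nil mul1r subrr coef0.
have [E [EB E_mon szE hE]] := IHk (ltnW lek).
pose c := nth 0 s k; have cs : c \in s by rewrite mem_nth.
have cB : c \in B by apply: sB.
have takeB : {subset take k s <= B} by move=> x /mem_take/sB.
have Ec : E.[c] \in I.
  apply: (@cofactor c (take k s) h E (\prod_(x <- drop k s) ('X - x%:P))) => //.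
  - rewrite big_seq_cond rpred_prod // => x; rewrite andbT => /mem_drop/sB xB.
    by rewrite rpredB ?polyOverX ?polyOverC.
  - by rewrite size_take_min (leq_trans (geq_minr _ _)) // szs leq_pred.
  - by rewrite dh -{1}(cat_take_drop k s) big_cat.
  - exact: hs.
have [F FB DE] := divX_root cB EB.
have szE1 : (1 < size E)%N by rewrite szE ltn_subRL addn1 ltnS (leq_trans lek) // szs leq_pred.
have DEF : E - (E.[c])%:P = F * ('X - c%:P) by rewrite {1}DE addrK.
have szEc : size (E - (E.[c])%:P) = size E.
  by rewrite size_polyDl // size_polyN (leq_ltn_trans (size_polyC_leq1 _)).
have lcEc : lead_coef (E - (E.[c])%:P) = 1.
  by rewrite lead_coefDl ?(monicP E_mon) // size_polyN (leq_ltn_trans (size_polyC_leq1 _)).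
have F_mon : F \is monic by rewrite -(monicMr _ (monicXsubC c)) -DEF; apply/monicP.
exists F; split=> //.
  have := szEc; rewrite DEF size_Mmonic ?monic_neq0 ?monicXsubC // size_XsubC szE.
  by rewrite addnC /= subnS => <-.
move=> i; rewrite (take_nth 0) // -cats1 big_cat big_seq1 /= -/c -mulrA [_ * F]mulrC -DEF.
rewrite mulrBr opprB addrCA coefD addrC ID //; last by rewrite addrC.
rewrite coefMC IM //; apply/polyOverP: i.
rewrite big_seq_cond rpred_prod // => x; rewrite andbT => /takeB xB.
by rewrite rpredB ?polyOverX ?polyOverC.
Qed.

(* Modulo [I], a monic [h] vanishing at its critical points is divisible by
   [h'], and [m h = (X - a) h'] forces [h = (X - a)^m]; so every point at which
   [h] vanishes is congruent to [a], in particular [0] and the critical points. *)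
Lemma critical_points_radical (h : {poly A}) (s : seq A) :
    (forall j x, (0 < j <= m)%N -> x *+ j \in B -> x \in B) ->
    (0 < m)%N -> critical_data m h s -> {subset s <= B} ->
    (forall x, x \in s -> h.[x] \in I) ->
  {subset s <= I}.
Proof.
move=> Bmuln m_gt0 [h_mon szh h0 szs dh] sB hs.
have hB : h \is a polyOver B.
  apply/polyOverP => -[|j]; first by rewrite -horner_coef0 h0 rpred0.
  have [lejm|ltmj] := leqP j.+1 m; last by rewrite nth_default ?rpred0 // szh.
  apply: (Bmuln j.+1) => //; rewrite -coef_deriv dh coefMn rpredMn //.
  move: j {lejm}; apply/polyOverP; rewrite big_seq_cond rpred_prod // => x; rewrite andbT => /sB xB.
  by rewrite rpredB ?polyOverX ?polyOverC.
have [a aB hE] := critical_cofactor sB szs m_gt0 h_mon szh hB dh hs.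
have [szH lcH] := shift_monic a h_mon szh.
have HB : shift a h \is a polyOver B by rewrite shiftB.
have Hj j : (j < m)%N -> (shift a h)`_j \in I.
  move=> ltjm; apply: (@Imuln (m - j)); first by lia.
    by apply/polyOverP.
  (* After the shift ['X - a] becomes ['X], and the coefficient of index [j] is [m - j] times that
     of [shift a h]. *)
  have : (shift a (h *+ m - h^`() * ('X - a%:P)))`_j \in I.
    apply: Icomp; last by rewrite rpredD ?polyOverX ?polyOverC.
    by move=> i; rewrite dh mulrnAl -mulrnBl coefMn Imulrn.
  rewrite /shift rmorphB rmorphM /= rmorphMn /= -/(shift a h).
  have -> : h^`() \Po ('X + a%:P) = (shift a h)^`().
    by rewrite deriv_comp derivD derivX derivC addr0 mulr1.
  rewrite comp_polyB comp_polyX comp_polyC addrK coefB coefMn coefMX.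
  by case: j ltjm => [|j] ltjm /=; rewrite ?subr0 ?subn0 // coef_deriv mulrnBr // ltnW.
have root_near x : x \in B -> h.[x] \in I -> x - a \in I.
  move=> xB; rewrite (shift_horner a) horner_coef szH big_ord_recr /= lcH mul1r => hx.
  apply: (@Iexp _ m); first by rewrite rpredB.
  rewrite -[X in X \in _](addKr (\sum_(i < m) (shift a h)`_i * (x - a) ^+ i)) addrC IB //.
  by apply: Isum => i _; rewrite IMr ?Hj // rpredX // rpredB.
have aI : a \in I.
  by have := root_near 0; rewrite h0 rpred0 sub0r => /(_ isT I0)/IN; rewrite opprK.
by move=> x xs; rewrite -(subrK a x) ID // root_near ?sB ?hs.
Qed.

End RadicalIdeal.

(** * Critical points and critical values *)

Section CriticalPoints.
Variables (R : realType) (F : fieldType) (m : nat).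
Hypothesis m_gt0 : (0 < m)%N.

Lemma critical_data_scale (h : {poly F}) (s : seq F) t : t != 0 -> critical_data m h s ->
  exists2 h1 : {poly F}, critical_data m h1 [seq x / t | x <- s] &
    forall y, h1.[y / t] = h.[y] / t ^+ m.
Proof.
move=> t0 [h_mon szh h0 szs dh].
have szt : size (t *: 'X : {poly F}) = 2%N by rewrite size_scale // size_polyX.
exists (t ^- m *: (h \Po (t *: 'X))); last first.
  by move=> y; rewrite hornerZ horner_comp hornerZ hornerX mulrCA divff // mulr1 mulrC.
have tm0 : t ^- m != 0 by rewrite invr_eq0 expf_neq0.
have szh1 : size (t ^- m *: (h \Po (t *: 'X))) = m.+1.
  by rewrite size_scale // size_comp_poly2.
split=> //; last 2 first.
- by rewrite size_map.
- rewrite derivZ deriv_comp dh derivZ derivX rmorphMn /= mulrnAl -scalerMnr.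
  congr (_ *+ _); rewrite rmorph_prod /= big_map.
  have -> : \prod_(x <- s) (('X - x%:P) \Po (t *: 'X)) =
      t ^+ size s *: \prod_(x <- s) ('X - (x / t)%:P).
    elim: (s) => [|x r IHr]; first by rewrite !big_nil scale1r.
    have Dx : ('X - x%:P) \Po (t *: 'X) = t *: ('X - (x / t)%:P).
      rewrite comp_polyB comp_polyX comp_polyC scalerBr -!mul_polyC -polyCM.
      by rewrite mulrCA divff // mulr1.
    by rewrite !big_cons IHr Dx exprS -scalerAl -scalerAr scalerA.
  rewrite -scalerAl -scalerAr !scalerA mulr1 -scalerA.
  by rewrite scalerA -mulrA -exprSr szs prednK // mulVf ?expf_neq0 // scale1r.
- rewrite monicE lead_coefZ lead_coef_comp ?szt // (monicP h_mon) lead_coefZ lead_coefX.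
  by rewrite szh mulr1 mul1r mulVf // expf_neq0.
- by rewrite hornerZ horner_comp hornerZ hornerX mulr0 h0 mulr0.
Qed.

End CriticalPoints.

(** Named so that it can be declared a ring morphism: it carries a polynomial over the ring of
    sequences to its [k]-th term. *)
Definition seq_eval (F : fieldType) (k : nat) (f : nat -> F) : F := f k.

Fact seq_eval_is_additive F k : zmod_morphism (@seq_eval F k).
Proof. by []. Qed.
Fact seq_eval_is_multiplicative F k : monoid_morphism (@seq_eval F k).
Proof. by []. Qed.
HB.instance Definition _ F k :=
  GRing.isZmodMorphism.Build _ _ (@seq_eval F k) (@seq_eval_is_additive F k).
HB.instance Definition _ F k :=
  GRing.isMonoidMorphism.Build _ _ (@seq_eval F k) (@seq_eval_is_multiplicative F k).

(** * Bounded and null sequences for a varying absolute value *)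

Section AbsvalSequences.
Variables (R : realType) (F : fieldType) (m : nat) (w : nat -> F -> R).
Hypotheses (m_gt0 : (0 < m)%N) (hw : forall k, is_absval (w k)).
Variable un : nat -> R.
Hypotheses (wn : forall k j, (0 < j <= m)%N -> w k j%:R = un j)
  (un_gt0 : forall j, (0 < j <= m)%N -> 0 < un j).

Definition bounded_pred : {pred nat -> F} :=
  fun f => `[< exists M, forall k, w k (f k) <= M >].

Definition null_pred : {pred nat -> F} :=
  fun f => `[< forall e, 0 < e -> \forall k \near \oo, w k (f k) < e >].

Lemma boundedP f : reflect (exists M, forall k, w k (f k) <= M) (f \in bounded_pred).
Proof. exact: asboolP. Qed.

Lemma nullP f : reflect (forall e, 0 < e -> \forall k \near \oo, w k (f k) < e)
  (f \in null_pred).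
Proof. exact: asboolP. Qed.

Lemma bounded_subring : subring_closed bounded_pred.
Proof.
split=> [|f g /boundedP[M fM] /boundedP[N gN]|f g /boundedP[M fM] /boundedP[N gN]].
- by apply/boundedP; exists 1 => k; rewrite absval1.
- apply/boundedP; exists (M + N) => k.
  by rewrite (le_trans (absvalB (hw k) _ _)) ?lerD.
- apply/boundedP; exists (M * N) => k.
  by rewrite (absvalM (hw k)) ler_pM ?absval_ge0.
Qed.

HB.instance Definition _ :=
  GRing.isSubringClosed.Build (nat -> F)%type bounded_pred bounded_subring.

Lemma wMn k x j : w k (x *+ j) = w k x * w k j%:R.
Proof. by rewrite -[x *+ j]mulr_natr absvalM. Qed.

(** The [h k] are the terms of one polynomial [H] over [nat -> F], and [critical_points_radical]
    applies to it with the bounded sequences as subring and the null sequences as ideal. *)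
Lemma critical_points_null (h : nat -> {poly F}) (s : nat -> seq F) :
    (forall k, critical_data m (h k) (s k)) ->
    (forall k x, x \in s k -> w k x <= 1) ->
    (forall e, 0 < e -> \forall k \near \oo, forall x, x \in s k -> w k (h k).[x] < e) ->
  forall i, (i < m.-1)%N -> forall e, 0 < e -> \forall k \near \oo, w k (s k)`_i < e.
Proof.
move=> hs s1 hs0 i lti; apply/nullP.
pose H : {poly nat -> F} := \poly_(j < m.+1) (fun k => (h k)`_j).
pose S : seq (nat -> F) := mkseq (fun i k => (s k)`_i) m.-1.
have szs k : size (s k) = m.-1 by case: (hs k).
have szS : size S = m.-1 by rewrite size_mkseq.
have evH k : map_poly (@seq_eval F k) H = h k.
  apply/polyP => j; rewrite coef_map coef_poly; case: ltnP => // lemj.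
  by rewrite raddf0 nth_default //; case: (hs k) => _ ->.
have evS k : map (@seq_eval F k) S = s k.
  apply: (@eq_from_nth _ 0) => [|j]; first by rewrite size_map szS szs.
  rewrite size_map szS => ltj; rewrite (nth_map 0) ?szS // nth_mkseq //.
have ev_inj (P Q : {poly nat -> F}) :
    (forall k, map_poly (@seq_eval F k) P = map_poly (@seq_eval F k) Q) -> P = Q.
  move=> PQ; apply/polyP => j; apply/funext => k.
  by have := congr1 (fun p : {poly F} => p`_j) (PQ k); rewrite !coef_map.
have ev_horner k P x : (P.[x] : nat -> F) k = (map_poly (@seq_eval F k) P).[x k].
  by rewrite -[x k]/(seq_eval k x) horner_map.
have Sx f k : f \in S -> f k \in s k.
  by move=> fS; rewrite -(evS k) (map_f (@seq_eval F k)).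
have Hm : H`_m = 1.
  apply/funext => k; rewrite coef_poly ltnSn; case: (hs k) => h_mon szh _ _ _.
  by rewrite -[RHS]/(1 : F) -(monicP h_mon) /lead_coef szh.
have szH : size H = m.+1.
  apply/eqP; rewrite eqn_leq size_poly ltnNge; apply/negP => /leq_sizeP/(_ m (leqnn _)).
  by move/eqP; rewrite Hm oner_eq0.
have cH : critical_data m H S.
  split=> //; first by rewrite monicE /lead_coef szH Hm.
    apply/funext => k; rewrite ev_horner evH -[X in _.[X]]/(0 : F).
    by case: (hs k).
  apply: ev_inj => k; rewrite -deriv_map evH rmorphMn rmorph_prod /=.
  case: (hs k) => _ _ _ _ ->; congr (_ *+ _); rewrite -{1}(evS k) big_map.
  by apply: eq_bigr => x _; rewrite rmorphB /= map_polyX map_polyC.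
have nullD f g : f \in null_pred -> g \in null_pred -> f + g \in null_pred.
  move=> /nullP f0 /nullP g0; apply/nullP => e e0.
  have e2 : 0 < e / 2 by rewrite divr_gt0.
  apply: filterS2 (f0 _ e2) (g0 _ e2) => k fk gk.
  by rewrite (le_lt_trans (absvalD (hw k) _ _)) // [ltRHS]splitr ltrD.
have nullM b f : b \in bounded_pred -> f \in null_pred -> b * f \in null_pred.
  move=> /boundedP[M bM] /nullP f0; apply/nullP => e e0.
  have M0 : 0 < `|M| + 1 by rewrite ltr_wpDl.
  have e1 : 0 < e / (`|M| + 1) by rewrite divr_gt0.
  have := f0 _ e1; apply: filterS => k; rewrite ltr_pdivlMr // => fk.
  rewrite (absvalM (hw k)) mulrC (le_lt_trans _ fk) // ler_wpM2l ?absval_ge0 //.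
  by rewrite (le_trans (bM k)) // (le_trans (ler_norm M)) // lerDl.
have null0 : 0 \in null_pred.
  by apply/nullP => e e0; near=> k; rewrite absval0.
have null_sqr f : f \in bounded_pred -> f ^+ 2 \in null_pred -> f \in null_pred.
  move=> _ /nullP f0; apply/nullP => e e0; have e2 : 0 < e ^+ 2 by rewrite exprn_gt0.
  have := f0 _ e2; apply: filterS => k; rewrite -[X in w k X]/(f k ^+ 2) absvalX //.
  by rewrite ltr_pXn2r ?nnegrE ?(absval_ge0 (hw k)) ?(ltW e0).
have fMn k f j : w k ((f *+ j) k) = w k (f k) * w k j%:R.
  by rewrite -wMn; congr (w k _); apply: (raddfMn (@seq_eval F k)).
have null_muln j f : (0 < j <= m)%N -> f \in bounded_pred -> f *+ j \in null_pred ->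
    f \in null_pred.
  move=> hj _ /nullP f0; apply/nullP => e e0.
  have e1 : 0 < e * un j by rewrite mulr_gt0 // un_gt0.
  have := f0 _ e1; apply: filterS => k.
  by rewrite fMn wn // ltr_pM2r // un_gt0.
have bounded_muln j f : (0 < j <= m)%N -> f *+ j \in bounded_pred -> f \in bounded_pred.
  move=> hj /boundedP[M fM]; apply/boundedP; exists (M / un j) => k.
  have := fM k.
  by rewrite fMn wn // ler_pdivlMr // un_gt0.
have := critical_points_radical (B := bounded_pred) nullD nullM null_sqr null_muln null0
  bounded_muln m_gt0 cH.
apply.
- by move=> f fS; apply/boundedP; exists 1 => k; apply/s1/Sx.
- move=> f fS; apply/nullP => e e0; have := hs0 e e0; apply: filterS => k.
  by rewrite ev_horner evH; apply; apply: Sx.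
- by apply/mapP; exists i => //; rewrite mem_iota.
Unshelve. all: by end_near. Qed.

End AbsvalSequences.

Lemma seq_argmax (R : realType) (T : eqType) (G : T -> R) (s : seq T) x0 : x0 \in s ->
  exists2 x, x \in s & forall y, y \in s -> G y <= G x.
Proof.
elim: s x0 => // y s IHs x0 _; case: s IHs => [|z s] IHs.
  by exists y; rewrite ?mem_head // => x; rewrite inE => /eqP->.
have [x xs hx] := IHs z (mem_head _ _).
have [le|lt] := leP (G x) (G y).
  exists y; rewrite ?mem_head // => t; rewrite in_cons => /orP[/eqP->//|/hx/le_trans]; exact.
exists x; first by rewrite in_cons xs orbT.
by move=> t; rewrite in_cons => /orP[/eqP->|/hx//]; apply: ltW.
Qed.

Section CriticalValueBound.
Variables (R : realType) (F : fieldType) (m : nat).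
Hypothesis m_gt0 : (0 < m)%N.

Definition critical_value_bound (w : F -> R) (K : R) : Prop :=
  forall h s M, critical_data m h s -> (forall y, y \in s -> w h.[y] <= M) ->
    forall x, x \in s -> w x ^+ m <= K * M.

(** Dividing the variable by the largest critical point [t] divides the critical values by [t ^ m],
    whose absolute value exceeds [K * M]. *)
Lemma critical_value_bound_normalize (w : F -> R) K h s M x :
    is_absval w -> 0 < K -> critical_data m h s ->
    (forall y, y \in s -> w h.[y] <= M) -> x \in s -> K * M < w x ^+ m ->
  exists h1 s1, [/\ critical_data m h1 s1, 1 \in s1, forall y, y \in s1 -> w y <= 1
    & forall y, y \in s1 -> w h1.[y] < K^-1].
Proof.
move=> hw K0 hs hM xs ltx; have [t ts ht] := seq_argmax w xs.
have M0 : 0 <= M by apply: le_trans (hM x xs); apply: absval_ge0.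
have tx : K * M < w t ^+ m.
  by rewrite (lt_le_trans ltx) // lerXn2r ?nnegrE ?(absval_ge0 hw) ?ht.
have wt0 : 0 < w t.
  rewrite lt0r (absval_ge0 hw) andbT; apply: contraTneq tx => ->.
  by rewrite expr0n gtn_eqF //= -leNgt mulr_ge0 // ltW.
have t0 : t != 0 by rewrite -(absval_gt0 hw).
have [h1 hs1 Dh1] := critical_data_scale m_gt0 t0 hs.
exists h1, [seq y / t | y <- s]; split=> //.
- by apply/mapP; exists t => //; rewrite divff.
- by move=> _ /mapP[y ys ->]; rewrite (absvalM hw) (absvalV hw) ler_pdivrMr // mul1r ht.
- move=> _ /mapP[y ys ->]; rewrite Dh1 (absvalM hw) (absvalV hw) (absvalX hw).
  rewrite ltr_pdivrMr ?exprn_gt0 // (le_lt_trans (hM y ys)) //.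
  by rewrite mulrC ltr_pdivlMr // mulrC.
Qed.

Section Ultrametric.
Variable w : F -> R.
Hypotheses (hw : is_absval w) (w_ultra : forall x y, w (x + y) <= Num.max (w x) (w y)).

Definition unit_ball : {pred F} := fun x => w x <= 1.

Lemma unit_ball_subring : subring_closed unit_ball.
Proof.
split=> [|x y|x y]; rewrite !unfold_in => *.
- by rewrite absval1.
- by rewrite (le_trans (w_ultra _ _)) // absvalN // ge_max; apply/andP.
- by rewrite absvalM // mulr_ile1 ?absval_ge0.
Qed.

HB.instance Definition _ := GRing.isSubringClosed.Build F unit_ball unit_ball_subring.

(** The ideal is the open unit ball inside the closed one. A rescaled violation has 1 among its
    critical points, and 1 is not in the open ball. *)
Lemma ultrametric_critical_value_bound :
  (forall j, (0 < j <= m)%N -> w j%:R = 1) -> critical_value_bound w 1.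
Proof.
move=> w1 h s M hs hM x xs; rewrite leNgt; apply/negP => lt.
have [h1 [s1 [hs1 s1_1 ball_s1 small]]] :=
  critical_value_bound_normalize hw ltr01 hs hM xs lt.
pose I : {pred F} := fun x => w x < 1.
have wMn y j : w (y *+ j) = w y * w j%:R by rewrite -[y *+ j]mulr_natr absvalM.
suff /(_ _ s1_1) : {subset s1 <= I} by rewrite unfold_in /= absval1 // ltxx.
apply: (critical_points_radical (B := unit_ball) (I := I) (m := m) _ _ _ _ _ _ _ hs1) => //.
- move=> y z; rewrite !unfold_in => y1 z1.
  by rewrite (le_lt_trans (w_ultra _ _)) // gt_max y1.
- move=> y z; rewrite !unfold_in => y1 z1.
  by rewrite absvalM // (le_lt_trans _ z1) // ler_piMl ?absval_ge0.
- by move=> y; rewrite !unfold_in absvalX // => _; rewrite expr_lt1 ?absval_ge0.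
- by move=> j y hj; rewrite !unfold_in wMn w1 // mulr1.
- by rewrite unfold_in /= absval0.
- by move=> j y hj; rewrite !unfold_in wMn w1 // mulr1.
- by move=> y /small; rewrite invr1.
Qed.

End Ultrametric.

(** If each [K = k + 1] fails for some absolute value of its own, the rescaled violations form a
    sequence whose critical points tend to 0, although 1 is always among them. *)
Lemma general_critical_value_bound (un : nat -> R) :
    (forall j, (0 < j <= m)%N -> 0 < un j) ->
  exists2 K, 1 <= K & forall w : F -> R, is_absval w ->
    (forall j, (0 < j <= m)%N -> w j%:R = un j) -> critical_value_bound w K.
Proof.
move=> un0; apply: contrapT => nK.
have viol k : exists whs : (F -> R) * ({poly F} * seq F),
    [/\ is_absval whs.1 /\ (forall j, (0 < j <= m)%N -> whs.1 j%:R = un j),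
      critical_data m whs.2.1 whs.2.2, 1 \in whs.2.2,
      forall y, y \in whs.2.2 -> whs.1 y <= 1
    & forall y, y \in whs.2.2 -> whs.1 (whs.2.1).[y] < k.+1%:R^-1].
  apply: contrapT => nwhs; apply: nK; exists k.+1%:R; first by rewrite ler1n.
  move=> w hw wn h s M hs hM x xs; rewrite leNgt; apply/negP => lt.
  have [//|h1 [s1 [? ? ? ?]]] := critical_value_bound_normalize hw _ hs hM xs lt.
  by apply: nwhs; exists (w, (h1, s1)).
have [whs hwhs] := choice viol.
pose w k := (whs k).1; pose h k := (whs k).2.1; pose s k := (whs k).2.2.
have hw k : is_absval (w k) by case: (hwhs k) => -[].
have wn k j : (0 < j <= m)%N -> w k j%:R = un j by case: (hwhs k) => -[_ h1] *; apply: h1.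
have hs k : critical_data m (h k) (s k) by case: (hwhs k).
have s1 k y : y \in s k -> w k y <= 1 by case: (hwhs k) => _ _ _ h1 _; apply: h1.
have hs0 e : 0 < e -> \forall k \near \oo, forall x, x \in s k -> w k (h k).[x] < e.
  move=> e0; exists (Num.bound e^-1) => // k /= lek x xs.
  have [_ _ _ _ /(_ x xs)/lt_trans] := hwhs k; apply.
  rewrite -[ltRHS]invrK ltf_pV2 ?posrE ?invr_gt0 //.
  by rewrite (lt_le_trans (archi_boundP _)) ?invr_ge0 ?ltW // ltr_nat ltnS.
have := critical_points_null m_gt0 hw wn un0 hs s1 hs0 => small.
have /filter_ex[k hk] : \forall k \near \oo, forall i : 'I_m.-1, w k (s k)`_i < 1.
  by apply: filter_forall => i; apply: small.
have [_ _ s_1 _ _] := hwhs k.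
have szs : size (s k) = m.-1 by case: (hs k).
have lti : (index 1%R (s k) < m.-1)%N by rewrite -szs index_mem.
by have := hk (Ordinal lti); rewrite /= nth_index // absval1 // ltxx.
Qed.

End CriticalValueBound.

(** * Growth and escape rates *)

(* The constants are 1 when [w] is ultrametric and [w j = 1] for [0 < j <= m]. *)
Section Growth.
Variables (R : realType) (F : fieldType) (m : nat) (w : F -> R) (kap mu K : R).
Hypotheses (m_gt0 : (0 < m)%N) (hw : is_absval w).
Hypotheses (kap1 : 1 <= kap) (mu1 : 1 <= mu) (K1 : 1 <= K).
Hypothesis w_quasi : forall x y, w (x + y) <= kap * Num.max (w x) (w y).
Hypothesis w_nat : forall j, (0 < j <= m)%N -> 0 < w j%:R /\ w m%:R <= mu * w j%:R.
Hypothesis w_crit : critical_value_bound m w K.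

Let kap0 : 0 <= kap. Proof. exact: le_trans kap1. Qed.
Let mu0 : 0 <= mu. Proof. exact: le_trans mu1. Qed.
Let K0 : 0 <= K. Proof. exact: le_trans K1. Qed.
Let w0 x : 0 <= w x := absval_ge0 hw x.

Lemma quasi_le x y M : w x <= M -> w y <= M -> w (x + y) <= kap * M.
Proof.
by move=> xM yM; rewrite (le_trans (w_quasi _ _)) // ler_wpM2l // ge_max xM.
Qed.

Lemma quasi_sum n (G : 'I_n -> F) M : 0 <= M -> (forall i, w (G i) <= M) ->
  w (\sum_(i < n) G i) <= kap ^+ n * M.
Proof.
move=> M0; elim: n G => [|n IHn] G GM; first by rewrite big_ord0 absval0 // expr0 mul1r.
rewrite big_ord_recr exprS -mulrA; apply: quasi_le; first exact: IHn.
by rewrite (le_trans (GM _)) // ler_peMl // exprn_ege1.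
Qed.

Lemma coef_prod_le (s : seq F) A j : 0 <= A -> (forall x, x \in s -> w x <= A) ->
  (j <= size s)%N ->
  w (\prod_(x <- s) ('X - x%:P))`_j <= kap ^+ size s * A ^+ (size s - j).
Proof.
move=> A0; elim: s j => [|x s IHs] j sA /=.
  by rewrite leqn0 => /eqP->; rewrite big_nil coefC /= absval1 // mulr1.
have xA : w x <= A by rewrite sA ?mem_head.
have {}IHs j : (j <= size s)%N -> _ :=
  IHs j (fun y ys => sA y (mem_behead (s := x :: s) ys)).
move=> lej; rewrite big_cons mulrBl coefB coefXM coefCM exprS -mulrA.
apply: quasi_le.
  case: j lej => [_|j lej] /=; last by rewrite subSS IHs.
  by rewrite absval0 // mulr_ge0 ?exprn_ge0.
rewrite absvalN // absvalM //; have [les|lts] := leqP j (size s).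
  rewrite (subSn les) exprS mulrCA ler_pM // IHs //.
have -> : (\prod_(y <- s) ('X - y%:P))`_j = 0 by rewrite nth_default // size_prod_XsubC.
by rewrite absval0 // mulr0 !mulr_ge0 ?exprn_ge0.
Qed.

Variables (g : {poly F}) (s : seq F) (B : R).
Hypotheses (g_mon : g \is monic) (szg : size g = m.+1) (szs : size s = m.-1).
Hypothesis dg : g^`() = (\prod_(x <- s) ('X - x%:P)) *+ m.
Hypotheses (gs : forall x, x \in s -> w g.[x] <= B) (g0 : w g.[0] <= B) (B1 : 1 <= B).

Let B0 : 0 <= B. Proof. exact: le_trans B1. Qed.

(** [K * kap * B] bounds the [m]-th power of the critical radius, its [kap] coming from the
    subtraction of [g(0)]; [mu * kap ^ m] is the cost of passing from the roots of [g'] to the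
    coefficients of [g]. *)
Let T := mu * kap ^+ m * (K * kap).

Lemma growth_const_ge1 : 1 <= T.
Proof. by rewrite !mulr_ege1 // exprn_ege1. Qed.

Let KB1 : 1 <= K * kap * B. Proof. by rewrite !mulr_ege1. Qed.

Let crit_radius : exists A, [/\ 0 <= A, A ^+ m <= K * kap * B & forall x, x \in s -> w x <= A].
Proof.
have [s0|s_gt0] := posnP (size s).
  exists 0; rewrite expr0n gtn_eqF //= (le_trans _ KB1) //; split=> // x.
  by move/size0nil: s0 => ->.
have [t ts ht] := seq_argmax w (mem_nth 0 s_gt0); exists (w t); split=> //.
have hdata : critical_data m (g - g.[0]%:P) s.
  have szc : (size (- g.[0]%:P) < size g)%N.
    by rewrite size_polyN szg ltnS (leq_trans (size_polyC_leq1 _)).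
  split=> //.
  - by rewrite monicE lead_coefDl ?(monicP g_mon).
  - by rewrite size_polyDl.
  - by rewrite !hornerE subrr.
  - by rewrite derivB derivC subr0.
rewrite -mulrA; apply: (w_crit hdata) ts => x xs.
by rewrite !hornerE; apply: quasi_le; [exact: gs|rewrite absvalN].
Qed.

Let coef_le A j : 0 <= A -> (forall x, x \in s -> w x <= A) -> (0 < j <= m)%N ->
  w g`_j <= mu * kap ^+ m * A ^+ (m - j).
Proof.
move=> A0 sA /andP[j0 jm]; have [wj0 wjm] : 0 < w j%:R /\ w m%:R <= mu * w j%:R.
  by apply: w_nat; rewrite j0.
case: j j0 jm wj0 wjm => // j _ jm wj0 wjm.
rewrite -(ler_pM2r wj0) -(absvalM hw) mulr_natr -coef_deriv dg coefMn -[_ *+ m]mulr_natr.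
rewrite (absvalM hw) mulrC.
have le1 := coef_prod_le A0 sA (_ : (j <= size s)%N); rewrite szs in le1.
have lej : (j <= m.-1)%N by rewrite -ltnS prednK.
apply: le_trans (ler_pM _ _ wjm (le1 lej)) _ => //.
have -> : (m.-1 - j = m - j.+1)%N by rewrite subnS -predn_sub.
have -> : mu * kap ^+ m * A ^+ (m - j.+1) * w j.+1%:R =
    mu * w j.+1%:R * (kap ^+ m * A ^+ (m - j.+1)) by ring.
rewrite ler_wpM2l ?mulr_ge0 // ler_wpM2r ?exprn_ge0 //.
by rewrite ler_weXn2l // leq_pred.
Qed.

Lemma coef_le_crit j : w g`_j <= T * B.
Proof.
have TB : B <= T * B by rewrite ler_peMl // growth_const_ge1.
have [A [A0 AB sA]] := crit_radius.
case: j => [|j]; first by rewrite -horner_coef0 (le_trans g0).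
have [lejm|ltmj] := leqP j.+1 m; last first.
  by rewrite nth_default ?szg // absval0 // (le_trans B0).
have TBE : T * B = mu * kap ^+ m * (K * kap * B) by rewrite /T !mulrA.
rewrite (le_trans (coef_le A0 sA _)) // TBE.
rewrite ler_wpM2l ?mulr_ge0 ?exprn_ge0 //.
have [A1|A1] := leP A 1; first by rewrite (le_trans _ KB1) // exprn_ile1.
by rewrite (le_trans _ AB) // ler_weXn2l ?leq_subr // ltW.
Qed.

(** The critical radius [A] is at most [K * kap * B], so [A / w y] is at most [K * kap / B <= 1];
    each term of index [0 < j < m] therefore loses at least one such factor against [y ^ m]. The
    constant term is at most [B <= w y ^ m / B]. *)
Lemma growth y : K * kap <= B -> B ^+ 2 <= w y ->
  w (g.[y] - y ^+ m) <= kap ^+ m * T / B * w y ^+ m.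
Proof.
move=> KB yB; have [A [A0 AB sA]] := crit_radius.
have Bpos : 0 < B by apply: lt_le_trans B1.
have Kk1 : 1 <= K * kap by rewrite mulr_ege1.
have Kk0 : 0 <= K * kap := le_trans ler01 Kk1.
have y1 : 1 <= w y by apply: le_trans yB; rewrite exprn_ege1.
have y0 : 0 < w y by apply: lt_le_trans y1.
have q0 : 0 <= K * kap / B by rewrite divr_ge0.
have q1 : K * kap / B <= 1 by rewrite ler_pdivrMr // mul1r.
have AK : A <= K * kap / B * w y.
  have AKB : A <= K * kap * B.
    have [A1|A1] := leP A 1; first exact: le_trans KB1.
    by rewrite (le_trans _ AB) // -[leLHS]expr1 ler_weXn2l // ltW.
  by rewrite (le_trans AKB) // -[leRHS]mulrA ler_wpM2l // [_ * w y]mulrC ler_pdivlMr.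
have -> : g.[y] - y ^+ m = \sum_(j < m) g`_j * y ^+ j.
  rewrite horner_coef szg big_ord_recr /= (_ : g`_m = 1) ?mul1r ?addrK //.
  by rewrite -[RHS](monicP g_mon) /lead_coef szg.
rewrite -2!mulrA; apply: quasi_sum => [|j].
  by rewrite !mulr_ge0 ?invr_ge0 ?exprn_ge0.
rewrite absvalM // absvalX //.
case: (posnP j) => [->|j_gt0].
  rewrite expr0 mulr1 -horner_coef0 (le_trans g0) //.
  have -> : T * (B^-1 * w y ^+ m) = T * w y ^+ m / B by ring.
  rewrite ler_pdivlMr // -expr2 (le_trans yB) //.
  rewrite -[leLHS]mul1r ler_pM ?growth_const_ge1 // -[leLHS]expr1 ler_weXn2l //.
have hj : (0 < j <= m)%N by rewrite j_gt0 ltnW.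
rewrite (le_trans (ler_wpM2r _ (coef_le A0 sA hj))) ?exprn_ge0 // /T.
have -> : mu * kap ^+ m * (K * kap) * (B^-1 * w y ^+ m) =
  mu * kap ^+ m * (K * kap / B * w y ^+ m) by ring.
rewrite -[leLHS]mulrA ler_wpM2l ?mulr_ge0 ?exprn_ge0 //.
have -> : w y ^+ m = w y ^+ (m - j) * w y ^+ j by rewrite -exprD subnK // ltnW.
rewrite mulrA ler_wpM2r ?exprn_ge0 //.
apply: le_trans (_ : (K * kap / B * w y) ^+ (m - j) <= _).
  by rewrite lerXn2r ?nnegrE // mulr_ge0.
rewrite exprMn ler_wpM2r ?exprn_ge0 //.
by rewrite -[leRHS]expr1 ler_wiXn2l // subn_gt0.
Qed.

End Growth.

Section LogPlus.
Variable R : realType.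
Implicit Types (t M : R).

Lemma log_plus_ge0 t : 0 <= log_plus t.
Proof. by rewrite /log_plus le_max lexx. Qed.

Lemma log_plus_ge1 t : 1 <= t -> log_plus t = ln t.
Proof. by move=> t1; rewrite /log_plus max_r // ln_ge0. Qed.

Lemma log_plus_le t M : t <= M -> 1 <= M -> log_plus t <= ln M.
Proof.
move=> tM M1; have lnM : 0 <= ln M by rewrite ln_ge0.
rewrite /log_plus ge_max lnM /=; have [t0|t0] := leP t 0; first by rewrite ln0.
by rewrite ler_ln ?posrE // (lt_le_trans t0).
Qed.

End LogPlus.

(* With [u_k = ln x_k], both [(u_k - ln rho) / D^k] and [-(u_k + ln rho) / D^k]
   are nondecreasing. *)
Lemma escape_bound (R : realType) (x : nat -> R) (D : nat) (B rho : R) :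
    (2 <= D)%N -> 1 <= rho -> rho <= B -> B <= x 0%N ->
    (forall k, B <= x k -> x k ^+ D / rho <= x k.+1 <= rho * x k ^+ D) ->
  cvgn (fun k => log_plus (x k) / (D ^ k)%:R) /\
  ln (x 0%N) - ln rho <= limn (fun k => log_plus (x k) / (D ^ k)%:R).
Proof.
move=> D2 rho1 rhoB Bx0 hx; have B1 : 1 <= B by apply: le_trans rhoB.
have rho0 : 0 < rho by apply: lt_le_trans rho1.
have xB k : B <= x k.
  elim: k => // k IHk; have /andP[le1 _] := hx k IHk.
  have x0 : 0 < x k by apply: lt_le_trans IHk; apply: lt_le_trans B1.
  apply: le_trans le1; rewrite ler_pdivlMr // (le_trans (_ : _ <= x k * x k)) //.
    by rewrite ler_pM ?(le_trans _ rhoB) ?(le_trans _ B1) ?(le_trans rhoB IHk) // ltW.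
  by rewrite -expr2 ler_weXn2l // (le_trans B1).
have x0 k : 0 < x k by apply: lt_le_trans (xB k); apply: lt_le_trans B1.
pose c := ln rho; have c0 : 0 <= c by rewrite ln_ge0.
pose u k := ln (x k).
have u0 k : 0 <= u k by rewrite ln_ge0 // (le_trans B1).
have Dge2 : 2 <= D%:R :> R by rewrite (ler_nat _ 2).
have D0 : 0 < D%:R :> R by apply: lt_le_trans Dge2.
have ustep k : D%:R * u k - c <= u k.+1 <= D%:R * u k + c.
  have /andP[le1 le2] := hx k (xB k).
  have xD : 0 < x k ^+ D by rewrite exprn_gt0.
  have DuE : D%:R * u k = ln (x k ^+ D) by rewrite lnXn // mulr_natl.
  rewrite DuE; apply/andP; split.
    by rewrite -ln_div ?posrE // ler_ln ?posrE ?divr_gt0.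
  by rewrite addrC -lnM ?posrE // ler_ln ?posrE ?mulr_gt0.
have Dk k : 0 < (D ^ k)%:R :> R by rewrite natrX exprn_gt0.
pose a k := (u k - c) / (D ^ k)%:R; pose b k := (u k + c) / (D ^ k)%:R.
have a_mono : {homo a : n k / (n <= k)%N >-> n <= k}.
  apply/nondecreasing_seqP => k; rewrite /a expnSr natrM invfM mulrA ler_pdivlMr //.
  rewrite mulrAC ler_wpM2r ?invr_ge0 // ?(ltW (Dk k)) //.
  by have /andP[h _] := ustep k; nra.
have b_anti k : b k <= b 0%N.
  elim: k => // k IHk; apply: le_trans IHk.
  rewrite /b expnSr natrM invfM mulrA ler_pdivrMr // mulrAC ler_wpM2r ?invr_ge0 ?(ltW (Dk k)) //.
  by have /andP[_ h] := ustep k; nra.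
have a_cvg : cvgn a.
  apply: nondecreasing_is_cvgn => //; exists (b 0%N) => _ [k _ <-].
  apply: le_trans (b_anti k); rewrite ler_wpM2r ?invr_ge0 ?(ltW (Dk k)) //; lra.
have c_cvg : (fun k => c / (D ^ k)%:R) @ \oo --> (0 : R).
  have h : `|D%:R^-1| < 1 :> R.
    by rewrite ger0_norm ?invr_ge0 ?(ltW D0) // invf_lt1 // (lt_le_trans _ Dge2) // ltr1n.
  rewrite -[X in _ --> X](mulr0 c); under eq_fun do rewrite natrX -exprVn.
  apply: cvgMr; exact: cvg_expr h.
have DE : (fun k => log_plus (x k) / (D ^ k)%:R) = (fun k => a k + c / (D ^ k)%:R).
  by apply/funext => k; rewrite log_plus_ge1 ?(le_trans B1) // -mulrDl subrK.
have lim_a : (fun k => log_plus (x k) / (D ^ k)%:R) @ \oo --> limn a.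
  by rewrite DE -[X in _ --> X]addr0; apply: cvgD.
split; first by apply/cvg_ex; exists (limn a).
rewrite (cvg_lim _ lim_a) //; have := nondecreasing_cvgn_le a_mono a_cvg 0%N.
by rewrite /a expn0 divr1.
Qed.

Section CriticalEscape.
Variables (R : realType) (w : algC -> R) (f : {poly algC}).

Lemma escape_rate_ge0 z : 0 <= escape_rate w f z.
Proof.
rewrite /escape_rate; set a := fun k => _.
(* If the sequence diverges, [limn] takes the default value 0. *)
have [ca|/dvgP->] := pselect (cvgn a); last exact: lexx.
by apply: limr_ge => //; apply: nearW => k; rewrite divr_ge0 ?log_plus_ge0.
Qed.

(** The functional equation of the escape rate. Growth is known from the critical value on, not from
    the critical point, and this step is the source of the factor [d m]. *)
Lemma escape_rate_step c : (1 < size f)%N ->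
    let b k := log_plus (w (poly_iter f k f.[c])) / ((size f).-1 ^ k)%:R in
  cvgn b -> (size f).-1%:R * escape_rate w f c = limn b.
Proof.
move=> szf b cb; have D0 : (size f).-1%:R != 0 :> R by rewrite pnatr_eq0; lia.
suff -> : escape_rate w f c = (size f).-1%:R^-1 * limn b by rewrite mulrA divff // mul1r.
apply: cvg_lim => //; rewrite -cvg_shiftS /=.
have -> : (fun k => log_plus (w (poly_iter f k.+1 c)) / ((size f).-1 ^ k.+1)%:R) =
    (fun k => (size f).-1%:R^-1 * b k).
  apply/funext => k; rewrite /b /poly_iter iterSr expnS natrM invfM; ring.
exact: cvgMr.
Qed.

Lemma le_lambda_crit c : f^`() != 0 -> root f^`() c ->
  escape_rate w f c <= lambda_crit w f.
Proof.
move=> f'0 f'c; apply: ub_le_sup; last by exists c.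
have [r Dr] := closed_field_poly_normal f^`().
exists (\big[Num.max/0]_(z <- r) escape_rate w f z) => _ [z /= f'z <-].
apply: (bigmax_sup_seq _ z) => //; move: f'z.
by rewrite Dr rootZ ?lead_coef_eq0 // root_prod_XsubC.
Qed.

End CriticalEscape.

Lemma tuple_norm_le (R : realType) (F : fieldType) (w : F -> R) (p : {poly F}) M :
  0 <= M -> (forall j, w p`_j <= M) -> tuple_norm w p <= M.
Proof.
by move=> M0 pM; rewrite /tuple_norm (big_nth 0) big_mkord; apply: bigmax_le.
Qed.

Lemma size_lead_deriv (F : numDomainType) (p : {poly F}) n : size p = n.+1 -> (0 < n)%N ->
  size p^`() = n /\ lead_coef p^`() = lead_coef p *+ n.
Proof.
move=> szp n0; have p0 : p != 0 by rewrite -size_poly_eq0 szp.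
have cn : p^`()`_n.-1 = lead_coef p *+ n by rewrite coef_deriv prednK // /lead_coef szp.
have cn0 : p^`()`_n.-1 != 0 by rewrite cn mulrn_eq0 negb_or -lt0n n0 lead_coef_eq0.
have sz : size p^`() = n.
  apply/eqP; rewrite eqn_leq -ltnS -szp lt_size_deriv //=.
  rewrite -(prednK n0) ltnNge; apply: contra cn0 => /leq_sizeP/(_ _ (leqnn _)) ->.
  exact: eqxx.
by rewrite /lead_coef sz cn /lead_coef szp.
Qed.

(** * The inequality at one place *)

Section LocalInequality.
Variables (R : realType) (m d : nat) (g : {poly algC}).
Hypotheses (m_gt0 : (0 < m)%N) (d_ge2 : (2 <= d)%N).
Hypotheses (g_mon : g \is monic) (szg : size g = m.+1).

Let f := g \Po 'X^d.

Lemma size_comp_Xn : (size f).-1 = (d * m)%N.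
Proof. by rewrite size_comp_poly szg size_polyXn mulnC. Qed.

Lemma root_deriv_comp_Xn c : c = 0 \/ root g^`() (c ^+ d) -> root f^`() c.
Proof.
rewrite /f deriv_comp derivXn /root hornerM horner_comp hornerXn hornerMn hornerXn.
case=> [->|/eqP->]; last by rewrite mul0r.
by rewrite (_ : 0 ^+ d.-1 = 0) ?mul0rn ?mulr0 // expr0n; case: (d) d_ge2 => [|[]].
Qed.

Let dm2 : (2 <= d * m)%N.
Proof. by rewrite (leq_trans d_ge2) // leq_pmulr. Qed.

Lemma size_comp_Xn_gt1 : (1 < size f)%N.
Proof. by move: dm2; rewrite -size_comp_Xn; case: (size f) => [|[|n]]. Qed.

Lemma deriv_comp_Xn_neq0 : f^`() != 0.
Proof.
have szf : size f = (size f).-1.+1 by rewrite prednK // ltnW // size_comp_Xn_gt1.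
have f1 : (0 < (size f).-1)%N by rewrite size_comp_Xn (leq_trans _ dm2).
by have [sz _] := size_lead_deriv szf f1; rewrite -size_poly_gt0 sz.
Qed.

Variables (w : algC -> R) (kap mu K thr rho : R).
Hypothesis hw : is_absval w.
Hypotheses (kap1 : 1 <= kap) (mu1 : 1 <= mu) (K1 : 1 <= K).
Hypothesis w_quasi : forall x y, w (x + y) <= kap * Num.max (w x) (w y).
Hypothesis w_nat : forall j, (0 < j <= m)%N -> 0 < w j%:R /\ w m%:R <= mu * w j%:R.
Hypothesis w_crit : critical_value_bound m w K.

Let T := mu * kap ^+ m * (K * kap).

Hypotheses (thr_K : K * kap <= thr) (rho1 : 1 <= rho) (rho_thr : rho <= thr).
Hypothesis w_near : forall x y B, thr < B -> w (x - y) <= kap ^+ m * T / B * w y ->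
  w y / rho <= w x <= rho * w y.

(** For [B <= thr] the coefficients of [g] are bounded outright; otherwise they are at most [T * B],
    and the critical value of size [B] escapes at rate at least [ln B - ln rho]. The hypothesis
    [w_near] hides how a small relative error is exploited: up to a factor 2 in general, as an
    equality in the ultrametric case. *)
Lemma local_inequality :
  log_plus (tuple_norm w g) <=
    (d * m)%:R * lambda_crit w f + (ln T + ln thr + ln rho).
Proof.
have T1 : 1 <= T by apply: growth_const_ge1.
have thr1 : 1 <= thr by apply: le_trans rho_thr.
have [s Ds] := closed_field_poly_normal g^`().
have [szg' lcg'] := size_lead_deriv szg m_gt0.
have m0 : m%:R != 0 :> algC by rewrite pnatr_eq0 -lt0n.
have dg : g^`() = (\prod_(x <- s) ('X - x%:P)) *+ m.
  by rewrite {1}Ds lcg' (monicP g_mon) scaler_nat.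
have szs : size s = m.-1.
  by move: szg'; rewrite Ds lcg' (monicP g_mon) size_scale // size_prod_XsubC => <-.
have crit_root x : x \in 0 :: s -> exists2 c, root f^`() c & f.[c] = g.[x].
  rewrite in_cons => /orP[/eqP->|xs].
    exists 0; first by apply: root_deriv_comp_Xn; left.
    by rewrite horner_comp hornerXn expr0n gtn_eqF // ltnW.
  have rd : (d.-root x) ^+ d = x by rewrite rootCK // ltnW.
  exists (d.-root x); last by rewrite horner_comp hornerXn rd.
  apply: root_deriv_comp_Xn; right; rewrite rd dg -mulr_natr rootM.
  by rewrite root_prod_XsubC xs.
have [t ts ht] := seq_argmax (fun x => w g.[x]) (mem_head 0 s).
have [c f'c fc] := crit_root t ts.
have gs x : x \in s -> w g.[x] <= w g.[t] by move=> xs; apply: ht; rewrite in_cons xs orbT.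
have g0 : w g.[0] <= w g.[t] by apply: ht; rewrite mem_head.
have lam := le_lambda_crit w deriv_comp_Xn_neq0 f'c.
have lam0 : 0 <= lambda_crit w f by apply: le_trans lam; apply: escape_rate_ge0.
have lnT : 0 <= ln T by rewrite ln_ge0.
have lnthr : 0 <= ln thr by rewrite ln_ge0.
have lnrho : 0 <= ln rho by rewrite ln_ge0.
have T0 : 0 < T by apply: lt_le_trans T1.
have [small|large] := leP (w g.[t]) thr.
  have coef := coef_le_crit m_gt0 hw kap1 mu1 K1 w_quasi w_nat w_crit g_mon szg szs dg
    (fun x xs => le_trans (gs x xs) small) (le_trans g0 small) thr1.
  have Tthr1 : 1 <= T * thr by rewrite mulr_ege1.
  have thr0 : 0 < thr by apply: lt_le_trans thr1.
  have := log_plus_le (tuple_norm_le (le_trans ler01 Tthr1) coef) Tthr1.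
  rewrite lnM ?posrE // => /le_trans; apply.
  by have := mulr_ge0 (ler0n R (d * m)) lam0; lra.
set B := w g.[t] in gs g0 large.
have B1 : 1 <= B by apply: le_trans (ltW large).
have B0 : 0 < B by apply: lt_le_trans B1.
have KB : K * kap <= B by apply: le_trans (ltW large).
have coef := coef_le_crit m_gt0 hw kap1 mu1 K1 w_quasi w_nat w_crit g_mon szg szs dg gs g0 B1.
have TB1 : 1 <= T * B by rewrite mulr_ege1.
have := log_plus_le (tuple_norm_le (le_trans ler01 TB1) coef) TB1.
rewrite lnM ?posrE // => /le_trans; apply.
have escape z : B <= w z -> w z ^+ (d * m) / rho <= w f.[z] <= rho * w z ^+ (d * m).
  move=> Bz; rewrite exprM -!(absvalX hw) horner_comp hornerXn.
  (* Only [B ^ 2] is retained of [B ^ d], so the constants do not depend on [d]. *)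
  have zB : B ^+ 2 <= w (z ^+ d).
    rewrite (absvalX hw) (le_trans (_ : _ <= w z ^+ 2)) //.
      by rewrite lerXn2r // nnegrE ?(ltW B0) // absval_ge0.
    by rewrite ler_weXn2l // (le_trans B1).
  have := growth m_gt0 hw kap1 mu1 K1 w_quasi w_nat w_crit g_mon szg szs dg gs g0 B1 KB zB.
  by rewrite -(absvalX hw); apply: w_near.
have [|cb lim_b] := @escape_bound R (fun k => w (poly_iter f k f.[c])) (d * m) B rho dm2 rho1
    (le_trans rho_thr (ltW large)) _ (fun k => escape (poly_iter f k f.[c])).
  by rewrite /poly_iter /= fc.
rewrite -size_comp_Xn in cb lim_b.
have Dlim := escape_rate_step size_comp_Xn_gt1 cb.
have : (size f).-1%:R * escape_rate w f c <= (size f).-1%:R * lambda_crit w f.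
  by rewrite ler_wpM2l.
rewrite {}Dlim -size_comp_Xn; move: lim_b; rewrite /= fc -/B.
move: (limn _) (_ * _) => l1 l2; lra.
Qed.

End LocalInequality.

(** * Heights *)

Lemma local_inequality_exists_const (R : realType) (m : nat) (u : rat -> R) : (0 < m)%N ->
  exists2 C : R, 0 <= C & forall (g : {poly algC}) (d : nat) (w : algC -> R),
    (2 <= d)%N -> g \is monic -> size g = m.+1 ->
    is_absval w -> (forall q : rat, w (ratr q) = u q) ->
  log_plus (tuple_norm w g) <= (d * m)%:R * lambda_crit w (g \Po 'X^d) + C.
Proof.
move=> m_gt0.
(* If nothing restricts to [u], any constant will do; otherwise [w0] shows that [u] is positive at
   [1, ..., m]. *)
have [[w0 [hw0 w0u]]|nw] := pselect (exists w0 : algC -> R,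
    is_absval w0 /\ forall q : rat, w0 (ratr q) = u q); last first.
  by exists 0 => // g d w _ _ _ hw wu; case: nw; exists w.
have wn (w : algC -> R) j : (forall q : rat, w (ratr q) = u q) -> w j%:R = u j%:R.
  by move=> wu; rewrite -wu ratr_nat.
have un0 j : (0 < j <= m)%N -> 0 < u j%:R.
  by move=> /andP[j0 _]; rewrite -(wn w0) // absval_gt0 // pnatr_eq0 -lt0n.
have [K K1 hK] := general_critical_value_bound algC m_gt0 un0.
(* The sum dominates every ratio [u m / u j]. *)
pose mu : R := 1 + \sum_(j < m) u m%:R / u j.+1%:R.
have um0 : 0 <= u m%:R by rewrite ltW // un0 // m_gt0 leqnn.
have umj0 (j : 'I_m) : 0 <= u m%:R / u j.+1%:R.
  by rewrite divr_ge0 // ltW // un0 //= ltn_ord.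
have mu1 : 1 <= mu by rewrite lerDl sumr_ge0.
have hmu j : (0 < j <= m)%N -> u m%:R <= mu * u j%:R.
  move=> hj; rewrite -ler_pdivrMr ?un0 //; case: j hj => // j /= hj.
  rewrite /mu (bigD1 (Ordinal hj)) //= addrCA lerDl addr_ge0 // sumr_ge0 //.
have kap1 : 1 <= 2 :> R by rewrite ler1n.
pose T : R := mu * 2 ^+ m * (K * 2); pose T' : R := 2 ^+ m * T.
have T1 : 1 <= T by apply: growth_const_ge1.
have T'1 : 1 <= T' by rewrite mulr_ege1 // exprn_ege1.
have T'T : T <= T' by rewrite ler_peMl ?exprn_ege1 // (le_trans ler01).
(* For [B > thr] the relative error [T' / B] is below 1/2, which allows [rho = 2]. *)
pose thr := 2 * T'.
exists (ln T + ln thr + ln 2).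
  by rewrite !addr_ge0 ?ln_ge0 // mulr_ege1.
move=> g d w d2 g_mon szg hw wu.
apply: (@local_inequality R m d g m_gt0 d2 g_mon szg w 2 mu K thr 2) => //.
- move=> x y; rewrite (le_trans (absvalD hw _ _)) // mulr2n mulrDl mul1r lerD //.
    by rewrite le_max lexx.
  by rewrite le_max lexx orbT.
- by move=> j hj; rewrite !(wn w) // un0 // hmu.
- by apply: hK => // j _; rewrite (wn w).
- rewrite /thr (le_trans (_ : _ <= T)) //.
    by rewrite ler_peMl ?(le_trans ler01) ?mulr_ege1 ?exprn_ege1.
  by rewrite (le_trans T'T) // ler_peMl // (le_trans ler01).
- by rewrite /thr ler_peMr.
move=> x y B ltB xy; have B0 : 0 < B.
  by apply: lt_trans ltB; rewrite mulr_gt0 // (lt_le_trans ltr01).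
have xy2 : w (x - y) <= w y / 2.
  rewrite (le_trans xy) // mulrC ler_wpM2l ?absval_ge0 //.
  rewrite -/T -/T' ler_pdivrMr // mulrC ler_pdivlMr // mulrC; exact: ltW.
have h1 : w x <= w (x - y) + w y by rewrite -{1}(subrK y x) absvalD.
have h2 : w y <= w (x - y) + w x by rewrite -{1}(subKr x y) [leRHS]addrC absvalB.
by have := absval_ge0 hw y; lra.
Qed.

Lemma good_local_inequality (R : realType) (m d p : nat) (g : {poly algC}) (w : algC -> R) :
    (0 < m < p)%N -> prime p -> (2 <= d)%N -> g \is monic -> size g = m.+1 ->
    is_absval w -> (forall q : rat, w (ratr q) = rat_padic_absval R p q) ->
  log_plus (tuple_norm w g) <= (d * m)%:R * lambda_crit w (g \Po 'X^d).
Proof.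
move=> /andP[m_gt0 ltmp] p_prime d2 g_mon szg hw wu.
have wn j : w j%:R = rat_padic_absval R p j%:R by rewrite -wu ratr_nat.
have w_ultra : forall x y, w (x + y) <= Num.max (w x) (w y).
  by apply: absval_ultrametric => // n; rewrite wn; apply: (padic_int_le1 _ p_prime n).
have w1 j : (0 < j <= m)%N -> w j%:R = 1.
  by move=> /andP[j0 jm]; rewrite wn padic_small // j0 (leq_ltn_trans jm).
rewrite -[leRHS]addr0.
(* With all constants equal to 1, the error term of [local_inequality] vanishes. *)
have -> : 0 = ln (1 * 1 ^+ m * (1 * 1)) + ln 1 + ln 1 :> R.
  by rewrite expr1n !mulr1 ln1 !addr0.
apply: (@local_inequality R m d g m_gt0 d2 g_mon szg w 1 1 1 1 1) => //.
- by move=> x y; rewrite mul1r.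
- by move=> j hj; rewrite !w1 ?m_gt0 ?leqnn // mul1r.
- exact: ultrametric_critical_value_bound.
move=> x y B B1; rewrite !expr1n !mulr1 div1r divr1 mul1r => xy.
have [y0|y0] := eqVneq y 0.
  move: xy; rewrite y0 absval0 // mulr0 subr0 => x0.
  by apply/andP; split=> //; apply: absval_ge0.
(* In an ultrametric this forces [w x = w y], so [rho = 1]. *)
have ltxy : w (x - y) < w y.
  rewrite (le_lt_trans xy) // gtr_pMl ?absval_gt0 // invf_lt1 // (lt_trans ltr01) //.
apply/andP; split.
  have := w_ultra x (y - x); rewrite addrC subrK absvalBC // le_max => /orP[//|].
  by rewrite leNgt ltxy.
by have := w_ultra (x - y) y; rewrite subrK => /le_trans; apply; rewrite ge_max lexx ltW.
Qed.

Lemma esumZ_le (R : realType) (I : choiceType) (S : set I) (a : I -> R) (k : R) : 0 <= k ->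
  (\esum_(i in S) (k * a i)%:E <= k%:E * \esum_(i in S) (a i)%:E)%E.
Proof.
move=> k0; apply: ge_ereal_sup => _ [X [finX sX] <-].
rewrite fsbig_finite //= sumEFin -mulr_sumr EFinM lee_wpmul2l ?lee_fin //.
by apply: esum_ge; exists X => //; rewrite fsbig_finite //= sumEFin.
Qed.

Lemma esum_lies_over_le (R : realType) (K : fieldExtType rat) (u : rat -> R) (C : R) :
    rat_std_absvals u -> 0 <= C ->
  (\esum_(v in places R K) (C * if v \in lies_over (K := K) u then local_weight v else 0)%:E
    <= C%:E)%E.
Proof.
move=> hu C0; apply: le_trans (esumZ_le _ _ C0) _.
rewrite -[leRHS]mule1 lee_wpmul2l ?lee_fin //.
have -> : (fun v : K -> R => (if v \in lies_over u then local_weight v else 0)%:E) =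
    (fun v => if v \in lies_over u then (local_weight v)%:E else 0%E).
  by apply/funext => v; case: ifP.
rewrite -esum_mkcondr (_ : places R K `&` lies_over u = lies_over u).
  exact: esum_local_weight_le1.
by apply/setIidr => v; apply: lies_over_place.
Qed.

Lemma is_extension_rat (R : realType) (K : fieldExtType rat)
    (iota : {rmorphism K -> algC}) (u : rat -> R) v w :
  lies_over u v -> is_extension iota v w -> forall q : rat, w (ratr q) = u q.
Proof.
move=> [_ vu] [_ wv] q; rewrite -vu -wv; congr w.
exact/esym/(fmorph_eq_rat (iota \o in_alg K)).
Qed.

Lemma tuple_norm_extension (R : realType) (K : fieldExtType rat)
    (iota : {rmorphism K -> algC}) (v : K -> R) w (gK : {poly K}) :
  is_extension iota v w -> tuple_norm w (map_poly iota gK) = tuple_norm v gK.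
Proof.
move=> [_ wv]; have -> : polyseq (map_poly iota gK) = [seq iota c | c <- gK].
  apply: (@eq_from_nth _ 0); first by rewrite size_map size_map_poly.
  by move=> j; rewrite size_map_poly => ltj; rewrite (nth_map 0) // coef_map.
by rewrite /tuple_norm big_map; apply: eq_bigr.
Qed.

(** The constant can be fixed before [K] because it is a sum over places of the rationals: the
    places of [K] above one of them have total weight at most 1. *)
Lemma poly_height_le (R : realType) (m : nat) : (0 < m)%N ->
  exists C : R, forall (g : {poly algC}) (d : nat),
    g \is monic -> size g = m.+1 -> (2 <= d)%N ->
    forall (K : fieldExtType rat) (iota : {rmorphism K -> algC}) (gK : {poly K}),
    map_poly iota gK = g ->
    forall ext : (K -> R) -> algC -> R,
    (forall v, places R K v -> is_extension iota v (ext v)) ->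
  (poly_height R gK <= (d * m)%:R%:E * crit_height ext (g \Po 'X^d) + C%:E)%E.
Proof.
move=> m_gt0.
(* The real place and the primes [p <= m]; at all other places there is no error term. *)
pose us : seq (rat -> R) := @rat_real_absval R ::
  [seq rat_padic_absval R p | p <- iota 0 m.+1 & prime p].
have us_std u : u \in us -> rat_std_absvals u.
  rewrite in_cons => /orP[/eqP->|/mapP[p]]; first by left.
  by rewrite mem_filter => /andP[p_prime _] ->; right; exists p.
have /choice[Cu hCu] : forall u : rat -> R, exists C : R, 0 <= C /\
    forall (g : {poly algC}) (d : nat) (w : algC -> R),
    (2 <= d)%N -> g \is monic -> size g = m.+1 ->
    is_absval w -> (forall q : rat, w (ratr q) = u q) ->
    log_plus (tuple_norm w g) <= (d * m)%:R * lambda_crit w (g \Po 'X^d) + C.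
  by move=> u; have [C C0 hC] := local_inequality_exists_const u m_gt0; exists C.
exists (\sum_(u <- us) Cu u) => g d g_mon szg d2 K iota gK Dg ext hext.
pose lam v := lambda_crit (ext v) (g \Po 'X^d).
have lam0 v : 0 <= lam v.
  have f'0 : root (g \Po 'X^d)^`() 0 by apply: root_deriv_comp_Xn => //; left.
  have f'n0 := deriv_comp_Xn_neq0 m_gt0 d2 szg.
  exact: le_trans (escape_rate_ge0 _ _ _) (le_lambda_crit (ext v) f'n0 f'0).
(* The error at [v] is written as a sum over [us] with only the term of the place below [v] possibly
   nonzero, so that the sums over [v] and [u] can be exchanged. *)
pose E v u := Cu u * if v \in lies_over (K := K) u then local_weight v else 0.
have E0 v u : 0 <= E v u.
  by rewrite mulr_ge0 //; [case: (hCu u)|case: ifP => // _; apply: local_weight_ge0].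
have le_loc v : places R K v ->
    ((local_weight v * log_plus (tuple_norm v gK))%:E <=
    ((d * m)%:R * (local_weight v * lam v))%:E + \sum_(u <- us) (E v u)%:E)%E.
  move=> pv; have [u hu vu] := place_over pv; have hw := hext v pv.
  have wu := is_extension_rat vu hw.
  rewrite -(tuple_norm_extension gK hw) Dg sumEFin -EFinD lee_fin mulrCA.
  have wt0 := local_weight_ge0 v; have habs : is_absval (ext v) by case: hw.
  have [uus|nus] := boolP (u \in us).
    apply: (le_trans (ler_wpM2l wt0 ((hCu u).2 g d (ext v) d2 g_mon szg habs wu))).
    have EvuE : local_weight v * Cu u = E v u by rewrite /E mem_set // mulrC.
    rewrite mulrDr lerD2l EvuE (big_rem u uus) lerDl sumr_ge0 // => y _; exact: E0.
  apply: le_trans (_ : local_weight v * ((d * m)%:R * lam v) <= _); last first.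
    by rewrite lerDl sumr_ge0 // => y _; apply: E0.
  rewrite ler_wpM2l //; case: hu => [Du|[p p_prime Du]].
    by case/negP: nus; rewrite Du mem_head.
  apply: (@good_local_inequality R m d p) => //; last by rewrite -Du.
  rewrite m_gt0 /= ltnNge; apply: contra nus => lepm; rewrite Du in_cons.
  by apply/orP; right; apply: map_f; rewrite mem_filter p_prime mem_iota.
apply: (le_trans (le_esum le_loc)).
rewrite esumD; last 2 first.
- by move=> v _; rewrite lee_fin mulr_ge0 // mulr_ge0 // local_weight_ge0.
- by move=> v _; rewrite sumEFin lee_fin sumr_ge0.
apply: leeD; first by apply: esumZ_le.
rewrite esum_sum; last by move=> v u _ _; rewrite lee_fin.
rewrite -sumEFin big_seq [leRHS]big_seq; apply: lee_sum => u /us_std hu.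
by apply: esum_lies_over_le => //; case: (hCu u).
Qed.

Lemma lambda_crit_PCF (R : realType) (w : algC -> R) (f : {poly algC}) :
  is_PCF f -> (2 <= (size f).-1)%N -> (exists c, root f^`() c) -> lambda_crit w f = 0.
Proof.
move=> pcf D2 [c0 f'c0].
have esc0 c : root f^`() c -> escape_rate w f c = 0.
  move=> /pcf/finite_seqP[s Ds]; apply: cvg_lim => //.
  (* Starting the maximum at 1 ensures that [ln M] bounds [log_plus] along the orbit. *)
  pose M := \big[Num.max/1]_(x <- s) w x.
  have wM k : w (poly_iter f k c) <= M.
    apply: (bigmax_sup_seq _ (poly_iter f k c)) => //.
    have : range (fun k => poly_iter f k c) (poly_iter f k c) by exists k.
    by rewrite Ds.
  have M1 : 1 <= M by apply: bigmax_ge_id.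
  have D1 : 1 < (size f).-1%:R :> R by rewrite ltr1n.
  apply: (@squeeze_cvgr _ _ _ _ (fun=> 0) (fun k => ln M * (size f).-1%:R^-1 ^+ k)).
  - apply: nearW => k; rewrite divr_ge0 ?log_plus_ge0 //= natrX exprVn.
    by rewrite ler_wpM2r ?invr_ge0 ?exprn_ge0 // log_plus_le.
  - exact: cvg_cst.
  - rewrite -[X in _ --> X](mulr0 (ln M)); apply: cvgMr; apply: cvg_expr.
    by rewrite ger0_norm ?invr_ge0 // invf_lt1 // (lt_trans ltr01).
have -> : lambda_crit w f = sup [set 0]; last exact: sup1.
congr sup; apply/seteqP; split=> [_ [c f'c <-]|_ ->]; first exact: esc0.
by exists c0 => //; apply: esc0.
Qed.

Theorem theorem1 (R : realType) (m : nat) (hm : (1 <= m)%N) :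
  (exists C : R,
     forall g : {poly algC}, g \is monic -> size g = m.+1 ->
     forall d : nat, (2 <= d)%N ->
     forall (K : fieldExtType rat) (iota : {rmorphism K -> algC})
            (gK : {poly K}), map_poly iota gK = g ->
     forall ext : (K -> R) -> algC -> R,
       (forall v, places R K v -> is_extension iota v (ext v)) ->
     ((((d * m)%:R : R)^-1)%:E * (poly_height R gK - C%:E)
        <= crit_height ext (g \Po 'X^d))%E)
  /\
  (exists B : R,
     forall g : {poly algC}, g \is monic -> size g = m.+1 ->
     (exists2 d : nat, (2 <= d)%N & is_PCF (g \Po 'X^d)) ->
     forall (K : fieldExtType rat) (iota : {rmorphism K -> algC})
            (gK : {poly K}), map_poly iota gK = g ->
     (poly_height R gK <= B%:E)%E).
Proof.
have [C hC] := poly_height_le R hm; split; exists C.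
  move=> g g_mon szg d d2 K iota gK Dg ext hext.
  have dm0 : 0 < (d * m)%:R :> R by rewrite ltr0n muln_gt0 hm (leq_trans _ d2).
  have := hC g d g_mon szg d2 K iota gK Dg ext hext.
  rewrite -leeBlDr // => le1.
  have inv0 : (0 <= ((d * m)%:R^-1 : R)%:E)%E by rewrite lee_fin invr_ge0 ltW.
  have := lee_wpmul2l inv0 le1.
  by rewrite muleA -EFinM mulVf ?gt_eqF // mul1e.
move=> g g_mon szg [d d2 pcf] K iota gK Dg.
have /choice[ext hext] : forall v : K -> R, exists w, places R K v -> is_extension iota v w.
  move=> v; have [[hv _]|npv] := pselect (places R K v); last by exists (fun=> 0).
  by have [w hw] := place_extension iota hv; exists w.
have := hC g d g_mon szg d2 K iota gK Dg ext hext.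
have -> : crit_height ext (g \Po 'X^d) = 0%E; last by rewrite mule0 add0e.
apply: esum1 => v _; rewrite lambda_crit_PCF ?mulr0 //.
  by rewrite (size_comp_Xn d szg) (leq_trans d2) // leq_pmulr.
by exists 0; apply: root_deriv_comp_Xn => //; left.
Qed.
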